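(* The maximum density of the ball/corner scheme (a cutting scheme of the $3$-simplex) is $12/11$; hence $\tau_3^* \le 12/11$.
   Context: Simplex and length. For $k\ge 3$ let $\Delta=\{x\in\mathbb{R}^k : x\ge 0,\ \sum_i x_i=1\}$; its $i$-th vertex (also called terminal $i$) is the point with $x_i=1$. The length $|e|$ of a line segment $e$ in $\Delta$ is half the $L_1$ distance between its endpoints. Cutting schemes. A $k$-way cut of the simplex is a partition of $\Delta$ into $k$ polytopes (polyhedral regions, not necessarily convex; how points on the common boundaries are assigned is immaterial), each containing exactly one vertex of $\Delta$. A cutting scheme is a probability distribution $P$ on $k$-way cuts of $\Delta$. For a line segment $e$ of positive length, the density $\tau_k(P,e)$ is the expected number of times a random cut from $P$ cuts $e$ (the number of points of $e$ at which $e$ crosses a boundary between blocks), divided by $|e|$. The maximum density of $P$ is $\tau_k(P)=\sup_e\tau_k(P,e)$, and $\tau_k^*=\inf_P\tau_k(P)$, the infimum being over all cutting schemes. The ball/corner scheme ($k=3$). Let $a=(2/3,1/3,0)$, $b=(2/3,0,1/3)$, $c=(0,2/3,1/3)$, $d=(0,1/3,2/3)$. With probability $8/11$ choose a ball cut, otherwise (probability $3/11$) choose a corner cut, where: Ball cut: choose a point $r$ uniformly at random from the union of the two segments $a$–$c$ and $b$–$d$. The three lines $\{x\in\Delta: x_i=r_i\}$, $i=1,2,3$, through $r$ parallel to the sides of the triangle are each divided by $r$ into two rays, giving six rays; each side of the triangle is hit by two of these rays. For each side choose (independently) uniformly at random one of the two rays that hit it. The three chosen rays form the boundary of the $3$-way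 cut. Corner cut: choose two of the three terminals uniformly at random, and choose $\rho\in(2/3,1]$ uniformly at random. The lines $\{x\in\Delta: x_i=\rho\}$ for the two chosen terminals $i$ form the boundary of the $3$-way cut. *)

(* Defs.v *)
From HB Require Import structures.
From mathcomp Require Import all_boot all_order all_algebra.
From mathcomp Require Import all_classical all_reals all_analysis.
From mathcomp Require Import measurable_realfun.

Set Implicit Arguments.
Unset Strict Implicit.
Unset Printing Implicit Defensive.

Import Order.TTheory GRing.Theory Num.Theory.
Import numFieldNormedType.Exports.

Local Open Scope classical_set_scope.
Local Open Scope ring_scope.

Section Simplex.
Variables (R : realType) (k : nat).
Local Notation point := 'rV[R]_k.

Definition simplex : set point :=
  [set x | (forall i, 0 <= x 0 i) /\ \sum_i x 0 i = 1].

Definition vertex (i : 'I_k) : point := delta_mx 0 i.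

Definition segment (x y : point) : set point :=
  [set (1 - t) *: x + t *: y | t in `[0, 1]].

Definition seglen (x y : point) : R := 2^-1 * \sum_i `|x 0 i - y 0 i|.

End Simplex.

Section Cuts.
Variables (R : realType) (k : nat).
Local Notation point := 'rV[R]_k.

(* [halfspace (a, b, true)] is closed, [halfspace (a, b, false)] is open. *)
Definition halfspace (h : point * R * bool) : set point :=
  let: (a, b, cl) := h in [set x | \sum_i a 0 i * x 0 i < b ?<= if cl].

(* Finite unions of finite intersections of closed or open halfspaces: this
   allows nonconvex regions that contain only part of their boundary. *)
Definition polyhedral (A : set point) : Prop :=
  exists s : seq (seq (point * R * bool)),
    forall x, A x <-> exists2 l, l \in s & forall h, h \in l -> halfspace h x.

(* A partition of the simplex into blocks indexed by the terminals; only the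
   values at points of the simplex matter. *)
Definition labelling := point -> 'I_k.

Definition block (c : labelling) (i : 'I_k) : set point :=
  [set x | simplex x /\ c x = i].

Definition kway_cut (c : labelling) : Prop :=
  forall i, polyhedral (block c i) /\ forall j, block c i (vertex R j) <-> i = j.

(* The points of the segment e = [x, y] every neighbourhood of which in e
   meets two different blocks. *)
Definition crossings (c : labelling) (x y : point) : set point :=
  [set p | segment x y p /\
           ~ (\forall q \near within (segment x y) (nbhs p), c q = c p)].

(* Equal to +oo when there are infinitely many crossings. *)
Definition ncrossings (c : labelling) (x y : point) : \bar R :=
  counting (crossings c x y).

End Cuts.

(* A distribution on labellings, given as the law of a random labelling on an
   arbitrary probability space. *)
Record random_labelling (R : realType) (k : nat) := RandomLabelling {
  sample_display : measure_display;
  sample_space : measurableType sample_display;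
  law : probability sample_space R;
  outcome : sample_space -> labelling R k
}.

Arguments law {R k} r.
Arguments outcome {R k} r _.

Section Density.
Variables (R : realType) (k : nat).
Implicit Types S : random_labelling R k.
Local Open Scope ereal_scope.

Definition cutting_scheme S : Prop :=
  {ae law S, forall w, kway_cut (outcome S w)} /\
  forall x y, simplex x -> simplex y -> x != y ->
    measurable_fun setT (fun w => ncrossings (outcome S w) x y).

Definition density S (x y : 'rV[R]_k) : \bar R :=
  (\int[law S]_w ncrossings (outcome S w) x y) * ((seglen x y)^-1)%:E.

Definition max_density S : \bar R :=
  ereal_sup [set d | exists x y : 'rV[R]_k,
    [/\ simplex x, simplex y, x != y & d = density S x y]].

End Density.

Definition opt_density (R : realType) (k : nat) : \bar R :=
  ereal_inf [set d | exists S : random_labelling R k,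
    cutting_scheme S /\ d = max_density S].

Section UniformOrdinal.
Variables (R : realType) (n : nat).

HB.instance Definition _ := isPointed.Build 'I_n.+1 ord0.
HB.instance Definition _ := @isMeasurable.Build default_measure_display
  'I_n.+1 discrete_measurable discrete_measurable0
  discrete_measurableC discrete_measurableU.

Definition uniform_ord : set 'I_n.+1 -> \bar R :=
  mscale (n.+1%:R^-1)%:nng (@counting 'I_n.+1 R).

HB.instance Definition _ := Measure.on uniform_ord.

Let uniform_ord_setT : uniform_ord [set: 'I_n.+1] = 1%E.
Proof.
have cardT : ([set: 'I_n.+1] #= `I_n.+1)%card by rewrite card_eq_sym card_II.
rewrite /uniform_ord /mscale/= /counting asboolT; last by exists n.+1.
by rewrite (card_fset_set cardT) -EFinM mulVf// pnatr_eq0.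
Qed.

HB.instance Definition _ :=
  Measure_isProbability.Build _ _ R uniform_ord uniform_ord_setT.

End UniformOrdinal.

Section CutAlong.
Variable R : realType.
Local Notation point := 'rV[R]_3.

(* The cut with boundary B: a point of the simplex off B goes to the terminal
   lying in the same connected component of the complement of B, and the points
   of B all go to terminal 0. *)
Definition cut_along (B : set point) : labelling R 3 := fun x =>
  odflt ord0
    [pick i | `[< connected_component (@simplex R 3 `\` B) (vertex R i) x >]].

End CutAlong.

Section BallCorner.
Variable R : realType.
Local Notation point := 'rV[R]_3.

Definition mkpoint (x y z : R) : point := \row_(i < 3) [:: x; y; z]`_i.

Definition pa := mkpoint (2 / 3) (1 / 3) 0.
Definition pb := mkpoint (2 / 3) 0 (1 / 3).
Definition pc := mkpoint 0 (2 / 3) (1 / 3).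
Definition pd := mkpoint 0 (1 / 3) (2 / 3).

(* The ray on the line x_m = r_m which starts at r and along which x_i
   increases, for i != m.  It hits the side x_j = 0, where j is the third
   index. *)
Definition ray (r : point) (m i : 'I_3) : set point :=
  [set x | [/\ simplex x, x 0 m = r 0 m & r 0 i <= x 0 i]].

(* The two rays that hit the side x_j = 0; indices are added modulo 3. *)
Definition side_ray (r : point) (j : 'I_3) (b : bool) : set point :=
  if b then ray r (j + 1) (j + 2) else ray r (j + 2) (j + 1).

Definition ball_boundary (r : point) (b : 'I_3 -> bool) : set point :=
  \bigcup_j side_ray r j (b j).

(* The two segments are disjoint and have the same length, so that a uniform
   point of their union is a uniform point of a segment chosen by a fair coin. *)
Definition ball_center (ac : bool) (t : R) : point :=
  if ac then (1 - t) *: pa + t *: pc else (1 - t) *: pb + t *: pd.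

(* Choosing two of the three terminals amounts to choosing the other one, s. *)
Definition corner_boundary (s : 'I_3) (rho : R) : set point :=
  [set x | simplex x /\ exists2 i, i != s & x 0 i = rho].

Lemma corner_range : 2 / 3 < 1 :> R.
Proof. by rewrite ltr_pdivrMr ?mul1r ?ltr_nat. Qed.

Definition coin (p : R) : probability bool R := bernoulli_prob p.

(* For each side, which of its two rays is chosen. *)
Definition bits_law : probability _ R :=
  (coin 2^-1 \x coin 2^-1 \x coin 2^-1)%E.

Definition ball_law : probability _ R :=
  ((coin 2^-1 \x uniform_prob (@ltr01 R)) \x bits_law)%E.

Definition corner_law : probability _ R :=
  (@uniform_ord R 2 \x uniform_prob corner_range)%E.

(* All the choices are sampled independently, both for a ball cut and for a
   corner cut; the first coin then decides which of the two cuts is used. *)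
Definition ball_corner_law : probability _ R :=
  (coin (8 / 11) \x ball_law \x corner_law)%E.

Definition clamp (lo hi t : R) : R := Num.min hi (Num.max lo t).

(* t and rho almost surely lie in the ranges to which they are clamped. *)
Definition ball_cut (w : bool * R * (bool * bool * bool)) : labelling R 3 :=
  let: (ac, t, (b0, b1, b2)) := w in
  cut_along (ball_boundary (ball_center ac (clamp 0 1 t))
               (fun j => nth false [:: b0; b1; b2] j)).

Definition corner_cut (w : 'I_3 * R) : labelling R 3 :=
  cut_along (corner_boundary w.1 (clamp (2 / 3) 1 w.2)).

Definition ball_corner : random_labelling R 3 :=
  RandomLabelling ball_corner_law (fun w =>
    let: (is_ball, u, v) := w in if is_ball then ball_cut u else corner_cut v).

End BallCorner.

(* Main.v *)
(* For almost every sample the blocks of the cut are convex: each is the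
   intersection of the simplex with open halfspaces bounded by lines parallel to
   its sides, up to boundary points.  A segment in general position therefore
   crosses the cut exactly at the points where it meets the boundary.
     Corner cut: averaging over s and rho, the line x_i = rho is used with
   probability 2/3, so the expected number of crossings is 2 sum_i k_i, where k_i
   is the length of the part of [x_i, y_i] in [2/3, 1].
     Ball cut: each of the six rays from r is chosen with probability 1/2, and a
   segment that avoids r meets the line x_i = r_i in exactly one of its two rays
   when r_i lies between x_i and y_i.  Each r_i is uniform on [0, 2/3], so the
   expected number of crossings is (3/4) sum_i c_i, where c_i is the length of the
   part of [x_i, y_i] in [0, 2/3].  A segment through r crosses the cut once
   instead of the 3/2 times given by this count, hence the correction below.
     Since (8/11)(3/4) = (3/11) 2 = 6/11 and c_i + k_i = |x_i - y_i|, the expected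
   number of crossings plus (4/11) P(r in [x, y]) equals 12/11 times the length
   of the segment.  The correction is nonnegative, and it vanishes on a side of
   the triangle. *)
Require Import Defs.
From mathcomp Require Import all_boot all_order all_algebra.
From mathcomp Require Import all_classical all_reals all_analysis.
From mathcomp Require Import measurable_realfun finmap ring lra.

Set Implicit Arguments.
Unset Strict Implicit.
Unset Printing Implicit Defensive.

Import Order.TTheory GRing.Theory Num.Theory.
Import numFieldNormedType.Exports.

Local Open Scope classical_set_scope.
Local Open Scope ring_scope.

(* [ball_center] is also a definition of mathcomp-analysis. *)
Local Notation ball_center := Defs.ball_center.

(** * Convex cells and the cuts they bound *)

Section Polyhedral.
Variables (R : realType) (k : nat).
Local Notation point := 'rV[R]_k.
Implicit Types A B : set point.

Lemma polyhedral_halfspace (h : point * R * bool) : polyhedral (halfspace h).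
Proof.
exists [:: [:: h]] => x; split=> [hx|[l]].
  by exists [:: h]; rewrite ?mem_head// => g; rewrite inE => /eqP ->.
by rewrite inE => /eqP -> /(_ h); apply; rewrite mem_head.
Qed.

Lemma polyhedralT : polyhedral [set: point].
Proof. by exists [:: [::]] => x; split=> // _; exists [::]. Qed.

Lemma polyhedral0 : polyhedral (set0 : set point).
Proof. by exists [::] => x; split=> // -[l]. Qed.

Lemma polyhedralU A B : polyhedral A -> polyhedral B -> polyhedral (A `|` B).
Proof.
move=> [s sA] [t tB]; exists (s ++ t) => x; split.
  case=> [/sA|/tB] [l ls lx]; exists l => //; rewrite mem_cat ls ?orbT//.
by case=> l; rewrite mem_cat => /orP[ls|lt] lx; [left; apply/sA|right; apply/tB];
  exists l.
Qed.

Lemma polyhedralI A B : polyhedral A -> polyhedral B -> polyhedral (A `&` B).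
Proof.
move=> [s sA] [t tB]; exists [seq l ++ m | l <- s, m <- t] => x; split.
  case=> /sA[l ls lx] /tB[m mt mx]; exists (l ++ m).
    by apply/allpairsP; exists (l, m).
  by move=> h; rewrite mem_cat => /orP[/lx|/mx].
case=> _ /allpairsP[[l m] /= [ls mt ->]] lmx; split.
  by apply/sA; exists l => // h hl; apply: lmx; rewrite mem_cat hl.
by apply/tB; exists m => // h hl; apply: lmx; rewrite mem_cat hl orbT.
Qed.

Lemma halfspaceC (h : point * R * bool) : polyhedral (~` halfspace h).
Proof.
case: h => [[a b] cl].
rewrite (_ : ~` _ = halfspace (- a, - b, ~~ cl)); first exact: polyhedral_halfspace.
have sumN (x : point) : \sum_i (- a) 0 i * x 0 i = - \sum_i a 0 i * x 0 i.
  by rewrite -sumrN; apply: eq_bigr => i _; rewrite mxE mulNr.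
apply/seteqP; split=> x /=; rewrite sumN; case: cl => /=.
- by move=> /negP; rewrite -ltNge ltrN2.
- by move=> /negP; rewrite -leNgt lerN2.
- by rewrite ltrN2 => xb; apply/negP; rewrite -ltNge.
- by rewrite lerN2 => xb; apply/negP; rewrite -leNgt.
Qed.

(** De Morgan, first on the union and then on each intersection, by induction on the two levels of
    lists. Complements give closed conditions from strict ones, and the block of terminal 0 from the
    other two blocks. *)
Lemma polyhedralC A : polyhedral A -> polyhedral (~` A).
Proof.
move=> [s]; elim: s A => [|l s ih] A sA.
  rewrite (_ : ~` A = setT); first exact: polyhedralT.
  by apply/seteqP; split=> // x _ /sA[].
pose A1 := [set x | forall h, h \in l -> halfspace h x].
pose A2 := [set x | exists2 l, l \in s & forall h, h \in l -> halfspace h x].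
have -> : A = A1 `|` A2.
  apply/seteqP; split=> x.
    move=> /sA[m]; rewrite inE => /orP[/eqP ->|ms] mx; first by left.
    by right; exists m.
  case=> [lx|[m ms mx]]; apply/sA; first by exists l; rewrite ?mem_head.
  by exists m => //; rewrite inE ms orbT.
rewrite setCU; apply: polyhedralI; last by apply: ih.
rewrite {}/A1; elim: l {sA} => [|h l ihl].
  rewrite (_ : ~` _ = set0); first exact: polyhedral0.
  by apply/seteqP; split=> // x; apply.
rewrite (_ : ~` _ = ~` halfspace h `|` ~` [set x | forall h, h \in l -> halfspace h x]).
  by apply: polyhedralU => //; exact: halfspaceC.
rewrite -setCI; congr (~` _); apply/seteqP; split=> x /=.
  by move=> hx; split=> [|g gl]; apply: hx; rewrite inE ?eqxx// gl orbT.
by move=> [hx lx] g; rewrite inE => /orP[/eqP ->|/lx].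
Qed.

Lemma polyhedral_coord_lt (i : 'I_k) (u : R) :
  polyhedral [set x : point | x 0 i < u].
Proof.
rewrite (_ : [set _ | _] = halfspace (delta_mx 0 i, u, false)).
  exact: polyhedral_halfspace.
apply/seteqP; split=> x /=; rewrite (bigD1 i)//= big1 ?mxE ?eqxx ?mul1r ?addr0//;
  by move=> j /negbTE ji; rewrite mxE ji andbF mul0r.
Qed.

Lemma polyhedral_coord_gt (i : 'I_k) (u : R) :
  polyhedral [set x : point | u < x 0 i].
Proof.
rewrite (_ : [set _ | _] = halfspace (- delta_mx 0 i, - u, false)).
  exact: polyhedral_halfspace.
apply/seteqP; split=> x /=; rewrite (bigD1 i)//= big1 ?mxE ?eqxx ?mulN1r ?addr0 ?ltrN2//;
  by move=> j /negbTE ji; rewrite !mxE ji andbF oppr0 mul0r.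
Qed.

Lemma polyhedral_simplex : polyhedral (@simplex R k).
Proof.
have -> : @simplex R k = [set x : point | forall i, i \in enum 'I_k -> 0 <= x 0 i] `&`
  (halfspace (const_mx 1, 1, true) `&` halfspace (- const_mx 1, - 1, true)).
  have sumE (x : point) : \sum_i const_mx 1 (0 : 'I_1) i * x 0 i = \sum_i x 0 i.
    by apply: eq_bigr => i _; rewrite mxE mul1r.
  have sumNE (x : point) : \sum_i (- const_mx 1) (0 : 'I_1) i * x 0 i = - \sum_i x 0 i.
    by rewrite -sumrN; apply: eq_bigr => i _; rewrite !mxE mulN1r.
  apply/seteqP; split=> x /=; rewrite sumE sumNE.
    by move=> [x0 ->].
  move=> [x0 [x1 x2]]; split=> [i|]; first by apply: x0; rewrite mem_enum.
  by apply/eqP; rewrite eq_le x1/= -lerN2.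
apply: polyhedralI; last by apply: polyhedralI; exact: polyhedral_halfspace.
elim: (enum 'I_k) => [|i s ih].
  by rewrite (_ : [set _ | _] = setT); [exact: polyhedralT|exact/seteqP].
rewrite (_ : [set _ | _] = ~` [set x : point | x 0 i < 0] `&`
    [set x : point | forall i, i \in s -> 0 <= x 0 i]).
  by apply: polyhedralI => //; apply: polyhedralC; exact: polyhedral_coord_lt.
apply/seteqP; split=> x /=.
  move=> xs; split=> [|j js]; last by apply: xs; rewrite inE js orbT.
  by apply/negP; rewrite -leNgt; apply: xs; rewrite mem_head.
by move=> [/negP + xs] j; rewrite -leNgt inE => x0 /orP[/eqP ->//|/xs].
Qed.

End Polyhedral.

(** * Segments, and connectedness of convex sets *)

Section Segment.
Variables (R : realType) (k : nat).
Implicit Types x y p : 'rV[R]_k.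

Lemma segment_coord x y t i :
  ((1 - t) *: x + t *: y) 0 i = (1 - t) * x 0 i + t * y 0 i.
Proof. by rewrite !mxE. Qed.

Lemma segment_left x y : segment x y x.
Proof.
exists 0; first by rewrite /= in_itv/= lexx ler01.
by rewrite subr0 scale1r scale0r addr0.
Qed.

Lemma segment_right x y : segment x y y.
Proof.
exists 1; first by rewrite /= in_itv/= lexx ler01.
by rewrite subrr scale1r scale0r add0r.
Qed.

Lemma segment_simplex x y : simplex x -> simplex y -> segment x y `<=` @simplex R k.
Proof.
move=> [x0 x1] [y0 y1] p [t /=]; rewrite in_itv/= => /andP[t0 t1] <-; split=> [i|].
  by rewrite segment_coord addr_ge0// mulr_ge0// subr_ge0.
under eq_bigr do rewrite segment_coord.
by rewrite big_split/= -!mulr_sumr x1 y1 !mulr1 subrK.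
Qed.

Lemma connected_segment x y : connected (segment x y).
Proof.
apply: connected_continuous_connected.
  exact: segment_connected.
apply: continuous_subspaceT => t.
apply: cvgD; apply: cvgZr_tmp; [apply: cvgB; [exact: cvg_cst|]|]; exact: cvg_id.
Qed.

(** A nonempty convex set is the union of the segments from one of its points, and all of these
    share that point. *)
Lemma convex_connected (A : set 'rV[R]_k) :
  (forall x y, A x -> A y -> segment x y `<=` A) -> connected A.
Proof.
move=> cA; have [->|/set0P[x Ax]] := eqVneq A set0; first exact: connected0.
rewrite (_ : A = \bigcup_(y in A) segment x y).
  by apply: bigcup_connected => [|y _]; [exists x => y _; exact: segment_left|
    exact: connected_segment].
apply/seteqP; split=> [y Ay|y [z Az]]; last exact: cA.
by exists y => //; exact: segment_right.
Qed.

End Segment.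

(** * Cells cut out of the simplex by strict bounds on coordinates *)

Section Cells.
Variables (R : realType) (k : nat).
Local Notation point := 'rV[R]_k.

Definition coord_cond (h : 'I_k * R * bool) (x : point) : bool :=
  if h.2 then h.1.2 < x 0 h.1.1 else x 0 h.1.1 < h.1.2.

(** All bounds are strict, so that a cell is both convex and relatively open in the simplex; this is
    what identifies cells with connected components. *)
Definition cell (L : seq ('I_k * R * bool)) : set point :=
  [set x | simplex x /\ all (coord_cond^~ x) L].

Lemma coord_cond_segment h x y : coord_cond h x -> coord_cond h y ->
  forall p, segment x y p -> coord_cond h p.
Proof.
case: h => [[i u] b] hx hy p [t + <-]; rewrite /= in_itv/= => /andP[t0 t1].
move: hx hy; rewrite /coord_cond/= segment_coord; move: (x 0 i) (y 0 i) => {}x {}y.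
by case: b => hx hy; have [->|] := eqVneq t 1; rewrite ?subrr ?mul1r ?mul0r ?add0r// => t1';
  have {t1'}t1 : t < 1 by [rewrite lt_neqAle t1' t1]; nra.
Qed.

Lemma cell_convex L x y : cell L x -> cell L y -> segment x y `<=` cell L.
Proof.
move=> [sx /allP Lx] [sy /allP Ly] p pxy; split; first exact: segment_simplex pxy.
apply/allP => h hL; exact: coord_cond_segment (Lx _ hL) (Ly _ hL) _ pxy.
Qed.

Lemma open_conds L : open [set x : point | all (coord_cond^~ x) L].
Proof.
elim: L => [|[[i u] b] L ih] /=.
  by rewrite (_ : [set _ | _] = setT); [exact: openT|exact/seteqP].
rewrite (_ : [set _ | _] =
    (fun x : point => x 0 i) @^-1` (if b then [set v | v > u] else [set v | v < u])
    `&` [set x : point | all (coord_cond^~ x) L]).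
  apply: openI => //; apply: open_comp => [x _|]; first exact: coord_continuous.
  by case: b; [exact: open_gt|exact: open_lt].
apply/seteqP; split=> x /=; rewrite /coord_cond/=; case: b => //.
- by move=> /andP.
- by move=> /andP.
- by move=> [/= -> ->].
- by move=> [/= -> ->].
Qed.

Lemma polyhedral_cell L : polyhedral (cell L).
Proof.
apply: polyhedralI; first exact: polyhedral_simplex.
change (polyhedral [set x : point | all (coord_cond^~ x) L]).
elim: L => [|[[i u] b] L ih] /=.
  by rewrite (_ : [set _ | _] = setT); [exact: polyhedralT|exact/seteqP].
rewrite (_ : [set _ | _] =
    (if b then [set x : point | u < x 0 i] else [set x : point | x 0 i < u])
    `&` [set x : point | all (coord_cond^~ x) L]).
  apply: polyhedralI => //.
  by case: b; [exact: polyhedral_coord_gt|exact: polyhedral_coord_lt].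
apply/seteqP; split=> x /=; rewrite /coord_cond/=; case: b => //.
- by move=> /andP.
- by move=> /andP.
- by move=> [/= -> ->].
- by move=> [/= -> ->].
Qed.

End Cells.

(** * Cuts along a boundary whose complement is a disjoint union of three cells *)

Section CellDecomposition.
Variable R : realType.
Local Notation point := 'rV[R]_3.

Lemma simplex_vertex (i : 'I_3) : simplex (vertex R i).
Proof.
split=> [j|]; first by rewrite mxE eqxx; case: (_ == _).
rewrite (bigD1 i)//= big1 ?mxE ?eqxx ?addr0//.
by move=> j /negbTE ji; rewrite mxE ji andbF.
Qed.

Variables (B : set point) (L : 'I_3 -> seq ('I_3 * R * bool)).
Hypothesis cell_vertex : forall i, cell (L i) (vertex R i).
Hypothesis cell_disj : forall i j x, cell (L i) x -> cell (L j) x -> i = j.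
Hypothesis cell_cover : forall x, simplex x -> (~ B x <-> exists i, cell (L i) x).

(** A cell is convex, hence lies in the component of its vertex. Conversely, the cells split that
    component into disjoint relatively open pieces; the piece containing the vertex is open and
    closed in it, hence is all of it. *)
Lemma component_cell i x : cell (L i) x ->
  forall j, connected_component (@simplex R 3 `\` B) (vertex R j) x <-> j = i.
Proof.
move=> Lx j; split=> [|->]; last first.
  apply: (connected_component_max (B := cell (L i))) => //.
    move=> y Ly; split; first by case: Ly.
    by apply/cell_cover; [case: Ly|exists i].
  exact/convex_connected/cell_convex.
have sub := @connected_component_sub _ (@simplex R 3 `\` B) (vertex R j).
move=> /[dup] Kx; have := @component_connected _ (@simplex R 3 `\` B) (vertex R j).
set K := connected_component _ _ in sub Kx *.
have Kv : K (vertex R j).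
  apply: connected_component_refl; split; first exact: simplex_vertex.
  by apply/cell_cover; [exact: simplex_vertex|exists j].
pose O i := [set x : point | all (fun h => coord_cond h x) (L i)].
have KO y l : K y -> O l y -> cell (L l) y by move=> /sub[].
move=> /(_ (K `&` O j)) cK _.
suff KE : K `&` O j = K.
  by apply: (cell_disj (x := x)) => //; apply: KO => //; rewrite -KE in Kx; case: Kx.
apply: cK; first by exists (vertex R j); split=> //; have [] := cell_vertex j.
- by exists (O j) => //; exact: open_conds.
(* Closedness: since the cells cover the component and are disjoint, its part in [O j] is what
   remains after removing the other open sets [O l]. *)
exists (~` \bigcup_(l in [set l | l != j]) O l).
  by apply: open_closedC; apply: bigcup_open => l _; exact: open_conds.
apply/seteqP; split=> y [Ky Oy]; split=> //=.
  move=> [l /= /eqP lj Ol]; apply: lj; exact: cell_disj (KO _ _ Ky Ol) (KO _ _ Ky Oy).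
have [sy yB] := sub _ Ky.
have [+ _] := cell_cover sy => /(_ yB)[l Ll].
have [<-|lj] := eqVneq l j; first by case: Ll.
by exfalso; apply: Oy; exists l => //; case: Ll.
Qed.

Lemma cut_along_cell i x : cell (L i) x -> cut_along B x = i.
Proof.
move=> Lx; rewrite /cut_along; case: pickP => [j /asboolP Kj|/(_ i)/asboolP[]].
  exact: (component_cell Lx j).1 Kj.
exact: (component_cell Lx i).2.
Qed.

Lemma cut_along_boundary x : B x -> cut_along B x = ord0.
Proof.
move=> Bx; rewrite /cut_along; case: pickP => // j /asboolP.
by move/connected_component_sub => -[].
Qed.

(** The blocks of terminals 1 and 2 are exactly their cells. The block of terminal 0 also receives
    the boundary, so it is obtained as the complement of the two others in the simplex. *)
Lemma cut_along_kway : kway_cut (cut_along B).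
Proof.
move=> i; split; last first.
  move=> j; split=> [[_]|->]; first by rewrite (cut_along_cell (cell_vertex j)).
  by split; [exact: simplex_vertex|exact: cut_along_cell (cell_vertex j)].
have blockE j : j != ord0 -> block (cut_along B) j = cell (L j).
  move=> /eqP j0; apply/seteqP; split=> x; last first.
    by move=> Lx; split; [case: Lx|exact: cut_along_cell].
  move=> [sx xj]; have [Bx|] := pselect (B x).
    by case: j0; rewrite -xj cut_along_boundary.
  by move=> /(cell_cover sx)[l] /[dup] Ll /cut_along_cell; rewrite xj => ->.
have [->|i0] := eqVneq i ord0; last by rewrite blockE//; exact: polyhedral_cell.
rewrite (_ : block _ _ =
    @simplex R 3 `&` ~` (block (cut_along B) 1 `|` block (cut_along B) 2%:R)).
  rewrite !blockE//; apply: polyhedralI; first exact: polyhedral_simplex.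
  by apply: polyhedralC; apply: polyhedralU; exact: polyhedral_cell.
apply/seteqP; split=> x; rewrite /block/=.
  by move=> [sx ->]; split=> // -[] [_].
move=> [sx x12]; split=> //; apply: contrapT => x0; apply: x12.
case: (cut_along B x) x0 => -[|[|[|//]]] //= H x0.
- by exfalso; apply: x0; exact/val_inj.
- by left; split=> //; exact/val_inj.
- by right; split=> //; exact/val_inj.
Qed.

End CellDecomposition.

(** * Crossings of a segment *)

Lemma counting_seq (R : realType) (T : choiceType) (A : set T) (s : seq T) :
  uniq s -> (forall x, A x <-> x \in s) -> counting A = (size s)%:R%:E :> \bar R.
Proof.
move=> us As; have finA : finite_set A.
  by apply/finite_seqP; exists s; apply/seteqP; split=> x /= /As.
rewrite /counting asboolT//; congr (_%:R%:E).
rewrite (_ : fset_set A = [fset x in s]%fset); first by rewrite card_fseq undup_id.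
apply/fsetP => x; rewrite in_fset_set// inE.
by apply/idP/idP => [/set_mem/As//|xs]; apply/mem_set/As.
Qed.

(** A count written as a sum of booleans over a fixed finite type can later be integrated term by
    term. *)
Lemma counting_image (R : realType) (T : choiceType) (I : finType) (A : set T)
    (h : pred I) (q : I -> T) :
  {in h &, injective q} -> (forall x, A x <-> exists2 j, h j & x = q j) ->
  counting A = (\sum_j h j)%:R%:E :> \bar R.
Proof.
move=> qi Aq; rewrite (@counting_seq _ _ _ [seq q j | j in h]).
- by rewrite size_map -cardE -sum1_card big_mkcond/=; congr (_%:R%:E);
    apply: eq_bigr => j _; rewrite unfold_in; case: (h j).
- rewrite map_inj_in_uniq ?enum_uniq// => i j.
  by rewrite !mem_enum; exact: qi.
- move=> x; rewrite Aq; split=> [[j hj ->]|/mapP[j]].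
    by apply: map_f; rewrite mem_enum.
  by rewrite mem_enum => hj ->; exists j.
Qed.

Lemma ncrossings_ge0 (R : realType) k (x y : 'rV[R]_k) (c : labelling R k) :
  (0 <= ncrossings c x y)%E.
Proof. by rewrite /ncrossings /counting; case: ifP; rewrite ?lee_fin ?leey. Qed.

Section Crossings.
Variables (R : realType) (B : set 'rV[R]_3) (L : 'I_3 -> seq ('I_3 * R * bool)).
Hypothesis cell_vertex : forall i, cell (L i) (vertex R i).
Hypothesis cell_disj : forall i j x, cell (L i) x -> cell (L j) x -> i = j.
Hypothesis cell_cover : forall x, simplex x -> (~ B x <-> exists i, cell (L i) x).
Variables x y : 'rV[R]_3.
Hypotheses (sx : simplex x) (sy : simplex y) (xy : x != y).

(* A boundary point p with the same label on both sides along the segment would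
   lie between two points of one convex cell. *)
Lemma crossings_cut_along : finite_set (segment x y `&` B) -> ~ B x -> ~ B y ->
  crossings (cut_along B) x y = segment x y `&` B.
Proof.
move=> finB Bx By; have cE i z : cell (L i) z -> cut_along B z = i.
  exact: cut_along_cell.
apply/seteqP; split=> p [sp pB]; split=> //.
  apply: contrapT => /(cell_cover (segment_simplex sx sy sp))[i Li]; apply: pB.
  have := open_nbhs_nbhs (conj (@open_conds R 3 (L i)) (proj2 Li)).
  apply: filterS => q qL sq; rewrite (cE i p Li); apply: cE; split=> //.
  exact: segment_simplex sq.
move=> near_p; move: sp => [t]; rewrite /= in_itv/= => /andP[t0 t1] pE.
have {}t0 : 0 < t.
  rewrite lt_neqAle t0 andbT; apply/eqP => t0'; apply: Bx.
  by move: pB; rewrite -pE -t0' subr0 scale1r scale0r addr0.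
have {}t1 : t < 1.
  rewrite lt_neqAle t1 andbT; apply/eqP => t1'; apply: By.
  by move: pB; rewrite -pE t1' subrr scale1r scale0r add0r.
(* The segment is reparametrised so that [p] is at [s = 0]. *)
pose g s := (1 - (t + s)) *: x + (t + s) *: y.
have gE s : g s = p + s *: (y - x).
  by rewrite -pE; apply/rowP => i; rewrite !mxE; ring.
have gp : g s @[s --> 0] --> p.
  rewrite (_ : p = p + 0 *: (y - x)); last by rewrite scale0r addr0.
  under eq_fun do rewrite gE.
  by apply: cvgD; [exact: cvg_cst|apply: cvgZr_tmp; exact: cvg_id].
have gneq s : s != 0 -> g s != p.
  move=> s0; rewrite gE -subr_eq0 addrAC subrr add0r scaler_eq0 negb_or s0/=.
  by rewrite subr_eq0 eq_sym.
have gseg s : 0 <= t + s <= 1 -> segment x y (g s).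
  by move=> ts; exists (t + s) => //; rewrite /= in_itv.
(* The segment has only finitely many other boundary points, so they stay away from [p]. *)
have near_S : \forall q \near p, ~ (segment x y `&` B `\ p) q.
  have clS : closed (segment x y `&` B `\ p).
    have /accessible_finite_set_closed :=
      hausdorff_accessible (@norm_hausdorff R 'rV[R]_3).
    by apply; exact: finite_setD.
  apply: open_nbhs_nbhs; split; first exact: closed_openC.
  by move=> -[_ /=]; apply.
have near_g : \forall s \near 0, segment x y (g s) ->
    cut_along B (g s) = cut_along B p /\ ~ (segment x y `&` B `\ p) (g s).
  suff : \forall q \near p, segment x y q ->
      cut_along B q = cut_along B p /\ ~ (segment x y `&` B `\ p) q by move=> /gp.
  near=> q => sq; split; first by move: sq; near: q.
  by near: q.
have [e /= e0 eg] := (nbhs_ballP _ _).1 near_g.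
(* The bound [e / 2] keeps [g d] and [g (- d)] in the good neighbourhood; [t] and [1 - t] keep them
   on the segment. *)
pose d := Num.min (e / 2) (Num.min t (1 - t)).
have d0 : 0 < d by rewrite !lt_min divr_gt0//= t0 subr_gt0.
have [de [dt d1t]] : d <= e / 2 /\ d <= t /\ d <= 1 - t.
  by rewrite /d !ge_min !lexx !orbT.
have gcell s : s != 0 -> `|s| <= d -> cell (L (cut_along B p)) (g s).
  move=> s0 sd; have ss : segment x y (g s) by apply: gseg; move: sd; rewrite ler_norml; lra.
  have bs : ball 0 e s by rewrite /ball/= sub0r normrN; lra.
  have [<- Sg] := eg s bs ss.
  have /cell_cover[+ _] : simplex (g s) by exact: segment_simplex ss.
  case=> [Bg|i Li]; last by rewrite (cE i).
  by apply: Sg; split=> //; exact/eqP/gneq.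
have gd := gcell d (lt0r_neq0 d0); rewrite ger0_norm ?(ltW d0)// lexx in gd.
have gNd := gcell (- d).
rewrite oppr_eq0 (lt0r_neq0 d0) normrN ger0_norm ?(ltW d0)// lexx in gNd.
(* The point [p] is the midpoint of [g d] and [g (- d)], which lie in the same convex cell. *)
have : cell (L (cut_along B p)) p.
  apply: (cell_convex (gd isT) (gNd isT isT)); exists 2^-1.
    by rewrite /= in_itv/=; lra.
  by rewrite -pE; apply/rowP => i; rewrite !mxE; field.
move=> Lp; have /cell_cover[_ +] : simplex p by case: Lp.
by apply => //; exists (cut_along B p).
Unshelve. all: by end_near. Qed.

Lemma ncrossings_image (I : finType) (h : pred I) (q : I -> 'rV[R]_3) :
    {in h &, injective q} ->
    (forall p, (segment x y `&` B) p <-> exists2 j, h j & p = q j) ->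
    ~ B x -> ~ B y ->
  ncrossings (cut_along B) x y = (\sum_j h j)%:R%:E.
Proof.
move=> qi Bq Bx By; rewrite /ncrossings crossings_cut_along//.
  exact: counting_image Bq.
apply: (@sub_finite_set _ _ (q @` setT)); last exact/finite_image/finite_finset.
by move=> p /Bq[j _ ->]; exists j.
Qed.

End Crossings.

(** * The point where a segment meets a level set of a coordinate *)

Section Levels.
Variables (R : realType) (k : nat).
Implicit Types x y p : 'rV[R]_k.

(** The product form is symmetric in [x] and [y], and an affine change of the variable only
    multiplies it by a square. *)
Definition separates x y (i : 'I_k) (v : R) : bool := (x 0 i - v) * (y 0 i - v) < 0.

(** If [x] and [y] agree in coordinate [i], the quotient is 0 and the point is [x]; this default is
    harmless, since [separates] is then false. *)
Definition level_point x y (i : 'I_k) (v : R) : 'rV[R]_k :=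
  let t := (v - x 0 i) / (y 0 i - x 0 i) in (1 - t) *: x + t *: y.

(** If the point with parameter [t] is at level [v], the product in [separates] equals
    [- t (1 - t) (y_i - x_i)^2], and [t] is determined because [y_i - x_i] is nonzero. *)
Lemma segment_levelP x y i v : x 0 i != v -> y 0 i != v ->
  forall p, segment x y p /\ p 0 i = v <->
    separates x y i v /\ p = level_point x y i v.
Proof.
move=> xv yv p; rewrite /separates; split=> [[[t + <-]]|[sv ->]].
  rewrite /= in_itv/= segment_coord => /andP[t0 t1] tv.
  have yx : y 0 i - x 0 i != 0.
    apply: contraNneq xv => yx; apply/eqP; rewrite -tv; nra.
  split; last first.
    rewrite /level_point (_ : _ / _ = t)//; apply: (mulIf yx); rewrite divfK//.
    by rewrite -tv; ring.
  have -> : (x 0 i - v) * (y 0 i - v) = - (t * (1 - t) * (y 0 i - x 0 i) ^+ 2).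
    by rewrite -tv; ring.
  rewrite oppr_lt0 mulr_gt0// ?exprn_even_gt0//; apply: mulr_gt0.
    rewrite lt_neqAle t0 andbT; apply: contraNneq xv => t0'.
    by rewrite -tv -t0'; apply/eqP; ring.
  rewrite subr_gt0 lt_neqAle t1 andbT; apply: contraNneq yv => t1'.
  by rewrite -tv t1'; apply/eqP; ring.
have yx : y 0 i - x 0 i != 0.
  apply/negP => /eqP/subr0_eq yx; move: sv; rewrite yx; nra.
split; last by rewrite /level_point segment_coord; field.
exists ((v - x 0 i) / (y 0 i - x 0 i)) => //.
rewrite /= in_itv/=; have [lt|gt] := ltP (x 0 i) (y 0 i).
  by rewrite ler_pdivlMr ?ler_pdivrMr ?subr_gt0// mul0r mul1r; nra.
have {}gt : y 0 i - x 0 i < 0 by lra.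
by rewrite ler_ndivlMr ?ler_ndivrMr// mul0r mul1r; nra.
Qed.

End Levels.

(** * Corner cuts and ball cuts *)

Lemma ord3_ind (P : 'I_3 -> Prop) : P 0 -> P 1 -> P 2 -> forall i, P i.
Proof.
move=> P0 P1 P2 [[|[|[|//]]] H].
- by rewrite (_ : Ordinal H = 0)//; exact/val_inj.
- by rewrite (_ : Ordinal H = 1)//; exact/val_inj.
- by rewrite (_ : Ordinal H = 2)//; exact/val_inj.
Qed.

Lemma ord3_ex (P : 'I_3 -> Prop) : (exists i, P i) <-> [\/ P 0, P 1 | P 2].
Proof.
split=> [[i]|[] Pi]; [|by exists 0|by exists 1|by exists 2].
by elim/ord3_ind: i; [constructor 1|constructor 2|constructor 3].
Qed.

Lemma ord3_add :
  ((0 + 1 = 1 :> 'I_3)%R * (0 + 2 = 2 :> 'I_3)%R * (1 + 1 = 2 :> 'I_3)%R *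
   (1 + 2 = 0 :> 'I_3)%R * (2 + 1 = 0 :> 'I_3)%R * (2 + 2 = 1 :> 'I_3)%R)%type.
Proof. by do !split; exact/val_inj. Qed.

Lemma sum_ord3 (V : nmodType) (f : 'I_3 -> V) : \sum_i f i = f 0 + f 1 + f 2.
Proof.
rewrite !big_ord_recr big_ord0 /= add0r.
by congr (f _ + f _ + f _); exact/val_inj.
Qed.

Ltac split_lra := rewrite /= ?ord3_add /= ?andbT ?mulr0n ?mulr1n;
  repeat match goal with
  | |- is_true (_ && _) -> _ => case/andP
  | |- is_true (_ && _) => apply/andP; split
  | |- _ -> _ => intro
  end; first [by []|lazymatch goal with
    | |- is_true _ => lra
    | _ => exfalso; lra
    end].

Section Simplex3.
Variable R : realType.
Implicit Types x : 'rV[R]_3.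

Lemma simplex3P x : simplex x <->
  [/\ 0 <= x 0 0, 0 <= x 0 1, 0 <= x 0 2 & x 0 0 + x 0 1 + x 0 2 = 1].
Proof.
rewrite /simplex/= sum_ord3; split=> [[x0 x1]|[x0 x1 x2 xs]]; first by split.
by split=> // i; elim/ord3_ind: i.
Qed.

Lemma vertexE (i j : 'I_3) : vertex R i 0 j = (i == j)%:R.
Proof. by rewrite mxE eqxx eq_sym. Qed.

Lemma simplex_le1 x i : simplex x -> x 0 i <= 1.
Proof. by move=> /simplex3P[]; elim/ord3_ind: i; lra. Qed.

End Simplex3.

(** * Corner cuts *)

Section Corner.
Variables (R : realType) (s : 'I_3) (rho : R).
Hypotheses (rho_lo : 2 / 3 < rho) (rho_hi : rho < 1).
Local Notation B := (corner_boundary s rho).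

(** The terminal [s], whose corner is not cut off, keeps the whole middle region. *)
Definition corner_cell (i : 'I_3) : seq ('I_3 * R * bool) :=
  if i == s then [:: (s + 1, rho, false); (s + 2, rho, false)]
  else [:: (i, rho, true)].

Lemma corner_cell_vertex i : cell (corner_cell i) (vertex R i).
Proof.
split; first exact: simplex_vertex.
rewrite /corner_cell; have [->|_] := eqVneq i s;
  rewrite /= /coord_cond/= !vertexE ?eqxx ?andbT//.
by move: rho_lo rho_hi; elim/ord3_ind: s; split_lra.
Qed.

Lemma corner_cell_disj i j x :
  cell (corner_cell i) x -> cell (corner_cell j) x -> i = j.
Proof.
move=> [/simplex3P[x0 x1 x2 xs] + ] [_ +]; rewrite /corner_cell /coord_cond.
move: rho_lo rho_hi.
by elim/ord3_ind: i; elim/ord3_ind: j; elim/ord3_ind: s => //; split_lra.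
Qed.

Lemma corner_cell_cover x : simplex x ->
  ~ B x <-> exists i, cell (corner_cell i) x.
Proof.
move=> sx; split=> [Bx|[i [_ Li]] [_ [j js xj]]].
  have neq i : i != s -> x 0 i != rho.
    by move=> si; apply/eqP => xi; apply: Bx; split=> //; exists i.
  have [i /andP[si xi]|small] := pickP (fun i => (i != s) && (rho < x 0 i)).
    by exists i; split=> //; rewrite /corner_cell (negbTE si)/= /coord_cond/= xi.
  have {}small i : i != s -> x 0 i < rho.
    by move=> si; rewrite lt_neqAle neq// leNgt; have := small i; rewrite si/= => ->.
  exists s; split=> //; rewrite /corner_cell eqxx/= /coord_cond/= !small//.
    by elim/ord3_ind: s.
  by elim/ord3_ind: s.
move/simplex3P : sx Li xj js => [x0 x1 x2 xs]; rewrite /corner_cell /coord_cond.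
move: rho_lo rho_hi.
by elim/ord3_ind: i; elim/ord3_ind: j; elim/ord3_ind: s => //; split_lra.
Qed.

Lemma corner_kway : kway_cut (cut_along B).
Proof.
exact: (cut_along_kway corner_cell_vertex corner_cell_disj corner_cell_cover).
Qed.

Lemma ncrossings_corner (x y : 'rV[R]_3) : simplex x -> simplex y -> x != y ->
    (forall i, x 0 i != rho) -> (forall i, y 0 i != rho) ->
  ncrossings (cut_along B) x y =
    (\sum_i ((i != s) && separates x y i rho))%:R%:E.
Proof.
move=> sx sy xy xr yr; rewrite /ncrossings.
have BE p : (segment x y `&` B) p <-> exists2 i, (i != s) && separates x y i rho &
    p = level_point x y i rho.
  split=> [[sp [_ [i si pi]]]|[i /andP[si xyi] pE]].
    by have [+ _] := segment_levelP (xr i) (yr i) p; case=> // xyi pE; exists i; rewrite ?si.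
  have [_ +] := segment_levelP (xr i) (yr i) p; case=> // sp pi; split=> //.
  by split; [exact: segment_simplex sp|exists i].
apply: (ncrossings_image corner_cell_vertex corner_cell_disj corner_cell_cover
  sx sy xy _ BE).
(* Level points for distinct coordinates differ: two coordinates equal to [rho > 2 / 3] would sum to
   more than 1. *)
- move=> i j /andP[_ iE] /andP[_ jE] ijE.
  have [_ /(_ (conj iE erefl))[spi pi]] :=
    segment_levelP (xr i) (yr i) (level_point x y i rho).
  have [_ /(_ (conj jE erefl))[_]] :=
    segment_levelP (xr j) (yr j) (level_point x y j rho).
  rewrite -ijE; move: pi (segment_simplex sx sy spi) => {ijE spi iE jE}.
  move: (level_point _ _ _ _) => p + /simplex3P[]; move: rho_lo.
  by elim/ord3_ind: i; elim/ord3_ind: j => //; split_lra.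
- by move=> [_ [i _]]; exact/eqP.
- by move=> [_ [i _]]; exact/eqP.
Qed.

End Corner.

(** * Ball cuts *)

Section Ball.
Variables (R : realType) (r : 'rV[R]_3) (b : 'I_3 -> bool).
Hypothesis r_gt0 : forall i, 0 < r 0 i.
Hypothesis simplex_r : simplex r.
Local Notation B := (ball_boundary r b).

Let r_lt1 i : r 0 i < 1.
Proof.
move: (r_gt0 0) (r_gt0 1) (r_gt0 2) simplex_r => r0 r1 r2 /simplex3P[_ _ _].
by elim/ord3_ind: i; lra.
Qed.

(* The sector x_i > r_i, x_j < r_j for j <> i, enlarged by the neighbouring
   sectors that no chosen ray separates from it. *)
Definition ball_cell (i : 'I_3) : seq ('I_3 * R * bool) :=
  (i, r 0 i, true) ::
    (if b (i + 1) then [:: (i + 2, r 0 (i + 2), false)] else [::]) ++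
    (if b (i + 2) then [::] else [:: (i + 1, r 0 (i + 1), false)]).

Lemma ball_cell_vertex i : cell (ball_cell i) (vertex R i).
Proof.
split; first exact: simplex_vertex.
rewrite /ball_cell/= all_cat /coord_cond/=.
by elim/ord3_ind: i; rewrite !ord3_add; do 2 case: ifP => _;
  rewrite /= !vertexE /= ?mulr0n ?mulr1n ?r_gt0 ?r_lt1.
Qed.

(** The bit of the side joining terminals [i] and [j] imposes either [x_j < r_j] on the cell of [i]
    or [x_i < r_i] on the cell of [j], against the first condition of the other cell. *)
Lemma ball_cell_disj i j x :
  cell (ball_cell i) x -> cell (ball_cell j) x -> i = j.
Proof.
move=> [/simplex3P[_ _ _ xs] + ] [_ +]; rewrite /ball_cell /coord_cond.
have /simplex3P[_ _ _ rs] := simplex_r.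
elim/ord3_ind: i; elim/ord3_ind: j => //; rewrite !ord3_add;
  case: (b 0); case: (b 1); case: (b 2); split_lra.
Qed.

Lemma ball_boundaryE x : simplex x -> B x <->
  [\/ side_ray r 0 (b 0) x, side_ray r 1 (b 1) x | side_ray r 2 (b 2) x].
Proof.
move=> sx; rewrite -(ord3_ex (fun j => side_ray r j (b j) x)).
by split=> [[j _ jx]|[j jx]]; exists j.
Qed.

Lemma side_rayE j c x : simplex x -> side_ray r j c x <->
  if c then (x 0 (j + 1) == r 0 (j + 1)) && (r 0 (j + 2) <= x 0 (j + 2))
  else (x 0 (j + 2) == r 0 (j + 2)) && (r 0 (j + 1) <= x 0 (j + 1)).
Proof.
by move=> sx; case: c; split=> [[_ /eqP -> ->]//|/andP[/eqP ? ?]]; split.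
Qed.

(** Both sides depend only on the bits and on how each [x_i] compares with [r_i]. The claim thus
    becomes an equality of booleans, checked case by case; comparisons that contradict the equal
    coordinate sums of [x] and [r] are discarded. *)
Lemma ball_cell_cover x : simplex x -> ~ B x <-> exists i, cell (ball_cell i) x.
Proof.
move=> sx; rewrite ball_boundaryE//.
have cE i : cell (ball_cell i) x <-> all (fun h => coord_cond h x) (ball_cell i).
  by split=> [[]|].
have -> : (exists i, cell (ball_cell i) x) <->
    [\/ cell (ball_cell 0) x, cell (ball_cell 1) x | cell (ball_cell 2) x].
  exact: ord3_ex.
suff -> : [\/ side_ray r 0 (b 0) x, side_ray r 1 (b 1) x | side_ray r 2 (b 2) x] <->
    ~~ [|| all (fun h => coord_cond h x) (ball_cell 0),
           all (fun h => coord_cond h x) (ball_cell 1) |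
           all (fun h => coord_cond h x) (ball_cell 2)].
  split=> [/negP|].
    by rewrite negbK => /or3P[]/cE; [constructor 1|constructor 2|constructor 3].
  by case=> /cE xc; apply/negP; rewrite negbK; apply/or3P;
    [constructor 1|constructor 2|constructor 3].
have -> : [\/ side_ray r 0 (b 0) x, side_ray r 1 (b 1) x | side_ray r 2 (b 2) x] <->
   [|| (if b 0 then (x 0 1 == r 0 1) && (r 0 2 <= x 0 2)
        else (x 0 2 == r 0 2) && (r 0 1 <= x 0 1)),
       (if b 1 then (x 0 2 == r 0 2) && (r 0 0 <= x 0 0)
        else (x 0 0 == r 0 0) && (r 0 2 <= x 0 2)) |
       (if b 2 then (x 0 0 == r 0 0) && (r 0 1 <= x 0 1)
        else (x 0 1 == r 0 1) && (r 0 0 <= x 0 0))].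
  split.
    by case=> /(side_rayE _ _ sx); rewrite !ord3_add => H; apply/or3P;
      [constructor 1|constructor 2|constructor 3]; case: ifP H.
  by move/or3P => [] H; [constructor 1|constructor 2|constructor 3];
    apply/(side_rayE _ _ sx); rewrite !ord3_add; case: ifP H.
have bool_iff (p q : bool) : p = q -> p <-> q by move=> ->.
apply: bool_iff.
rewrite /ball_cell !ord3_add /coord_cond /=.
have /simplex3P[_ _ _ rs] := simplex_r; have /simplex3P[_ _ _ xs] := sx.
case: (ltrgtP (x 0 0) (r 0 0)) => c0; case: (ltrgtP (x 0 1) (r 0 1)) => c1;
  case: (ltrgtP (x 0 2) (r 0 2)) => c2; try (exfalso; lra);
  case: (b 0); case: (b 1); case: (b 2) => /=;
  rewrite ?c0 ?c1 ?c2 ?ltxx /= ?(ltW c0) ?(ltW c1) ?(ltW c2) ?orbT // ?andbT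
    ?orbT ?andbF ?orbF // ?ltxx //.
Qed.

Lemma ball_kway : kway_cut (cut_along B).
Proof.
exact: (cut_along_kway ball_cell_vertex ball_cell_disj ball_cell_cover).
Qed.

(** Rays on different lines fix two coordinates, and the sum fixes the third. Opposite rays on one
    line bound the two other coordinates from below by those of [r], and the sum forces equality. *)
Lemma side_rayI i j ci cj p : (i, ci) != (j, cj) ->
  side_ray r i ci p -> side_ray r j cj p -> p = r.
Proof.
move=> ij ip jp; have sp : simplex p by case: ci ip {ij} => -[].
move: ij ip jp => /negP ij /(side_rayE _ _ sp) ip /(side_rayE _ _ sp) jp.
have /simplex3P[_ _ _ rs] := simplex_r; have /simplex3P[_ _ _ ps] := sp.
suff [p0 [p1 p2]] : p 0 0 = r 0 0 /\ p 0 1 = r 0 1 /\ p 0 2 = r 0 2.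
  by apply/rowP => l; elim/ord3_ind: l.
move: ij ip jp; elim/ord3_ind: i; elim/ord3_ind: j; case: ci; case: cj;
  rewrite !ord3_add => ij; try (by exfalso; apply: ij);
  by move=> /andP[/eqP e1 l1] /andP[/eqP e2 l2]; lra.
Qed.

Lemma ball_center_boundary : B r.
Proof. by exists 0 => //; case: (b 0). Qed.

Lemma ball_boundary_level p : B p -> exists i, p 0 i = r 0 i.
Proof. by case=> j _; case: (b j) => -[]; eexists; eassumption. Qed.

End Ball.

(** * Crossings of a segment with a ball cut of given centre *)

Section BallCrossings.
Variables (R : realType) (r x y : 'rV[R]_3).
Hypothesis r_gt0 : forall i, 0 < r 0 i.
Hypothesis simplex_r : simplex r.
Hypotheses (sx : simplex x) (sy : simplex y) (xy : x != y).
Hypotheses (xr : forall i, x 0 i != r 0 i) (yr : forall i, y 0 i != r 0 i).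

Definition on_segment (p : 'rV[R]_3) : bool := `[< segment x y p >].

Definition hits_ray (j : 'I_3) (c : bool) : bool :=
  `[< segment x y `&` side_ray r j c !=set0 >].

Let lvl i := level_point x y i (r 0 i).
Let lvlP i p := @segment_levelP R 3 x y i (r 0 i) (xr i) (yr i) p.
Let idx (j : 'I_3) (c : bool) := if c then j + 1 else j + 2.

Let side_ray_level j c p : side_ray r j c p -> p 0 (idx j c) = r 0 (idx j c).
Proof. by case: c => -[]. Qed.

(** The segment meets each line [x_i = r_i] at most once. If it contains [r], that meeting point is
    always [r], so there is one crossing. Otherwise each chosen ray contributes at most one point,
    and these points differ because two rays share only [r]. *)
Lemma ncrossings_ball (b : 'I_3 -> bool) :
  ncrossings (cut_along (ball_boundary r b)) x y =
    (if on_segment r then 1 else \sum_j hits_ray j (b j))%N%:R%:E.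
Proof.
have Bx : ~ ball_boundary r b x by move=> /ball_boundary_level[i /eqP]; exact/negP.
have By : ~ ball_boundary r b y by move=> /ball_boundary_level[i /eqP]; exact/negP.
have disj := ball_cell_disj (b := b) simplex_r.
have cover := ball_cell_cover b simplex_r.
have vert := ball_cell_vertex b r_gt0 simplex_r.
rewrite /on_segment; case: asboolP => [rs|rs].
  rewrite (ncrossings_image vert disj cover sx sy xy (h := xpredT) (q := fun _ : unit => r)) //.
  - by rewrite big_const cardE enumT unlock.
  - by move=> [] [].
  - move=> p; split=> [[ps /ball_boundary_level[i pi]]|[_ _ ->]].
      exists tt => //; have [/(_ (conj ps pi))[_ ->] _] := lvlP i p.
      by have [/(_ (conj rs erefl))[_ <-] _] := lvlP i r.
    by split=> //; exact: ball_center_boundary.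
apply: (ncrossings_image vert disj cover sx sy xy (q := fun j => lvl (idx j (b j)))) => //.
- move=> i j; rewrite !unfold_in => /asboolP[p [ps ip]] /asboolP[q [qs jq]] pq.
  have [/(_ (conj ps (side_ray_level ip)))[_ pE] _] := lvlP (idx i (b i)) p.
  have [/(_ (conj qs (side_ray_level jq)))[_ qE] _] := lvlP (idx j (b j)) q.
  have pqE : p = q by rewrite pE qE.
  apply: contrapT => ij; apply: rs; rewrite -(_ : p = r)//.
  apply: (@side_rayI R r simplex_r i j (b i) (b j)) => //; last by rewrite pqE.
  by apply/eqP => -[].
- move=> p; split=> [[ps [j _ jp]]|[j /asboolP[q [qs jq]] ->]].
    exists j; first by apply/asboolP; exists p.
    by have [/(_ (conj ps (side_ray_level jp)))[_ ->] _] := lvlP (idx j (b j)) p.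
  have [/(_ (conj qs (side_ray_level jq)))[_ qE] _] := lvlP (idx j (b j)) q.
  by rewrite /lvl -qE; split=> //; exists j.
Qed.

(** The two rays named here are the opposite halves of the line [x_i = r_i]. The meeting point of
    the segment with this line is not [r], hence lies on exactly one half. *)
Lemma hits_line (i : 'I_3) : ~~ on_segment r ->
  (hits_ray (i + 2)%R true + hits_ray (i + 1)%R false = separates x y i (r 0 i)%R)%N.
Proof.
move=> /asboolP rs.
have other_coord (j : 'I_3) (p : 'rV[R]_3) : simplex p -> p 0 j = r 0 j ->
    p 0 (j + 1) < r 0 (j + 1) -> r 0 (j + 2) <= p 0 (j + 2).
  have /simplex3P[_ _ _ rs1] := simplex_r; move=> /simplex3P[_ _ _ ps1].
  by elim/ord3_ind: j; rewrite !ord3_add => e l; lra.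
have neqr : (i + 2, true) != (i + 1, false) :> 'I_3 * bool by elim/ord3_ind: i.
have rayT p : side_ray r (i + 2) true p <->
    [/\ simplex p, p 0 i = r 0 i & r 0 (i + 1) <= p 0 (i + 1)].
  by clear neqr; elim/ord3_ind: i; rewrite /side_ray !ord3_add.
have rayF p : side_ray r (i + 1) false p <->
    [/\ simplex p, p 0 i = r 0 i & r 0 (i + 2) <= p 0 (i + 2)].
  by clear neqr rayT; elim/ord3_ind: i; rewrite /side_ray !ord3_add.
have [sep|nsep] := boolP (separates x y i (r 0 i)); last first.
  have nohit p : segment x y p -> p 0 i = r 0 i -> False.
    by move=> ps pi; have [/(_ (conj ps pi))[sep]] := lvlP i p; rewrite sep in nsep.
  rewrite /hits_ray asboolF ?asboolF// => -[p [ps]].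
    by move=> /rayF[_ + _]; exact: nohit.
  by move=> /rayT[_ + _]; exact: nohit.
have [_ /(_ (conj sep erefl))[ls li]] := lvlP i (lvl i).
have sl := segment_simplex sx sy ls.
have lvlE p : segment x y p -> p 0 i = r 0 i -> p = lvl i.
  by move=> ps pi; have [/(_ (conj ps pi))[]] := lvlP i p.
have one : side_ray r (i + 2) true (lvl i) \/ side_ray r (i + 1) false (lvl i).
  have [le|gt] := leP (r 0 (i + 1)) (lvl i 0 (i + 1)); first by left; apply/rayT.
  by right; apply/rayF; split=> //; exact: other_coord.
have notboth : ~ (side_ray r (i + 2) true (lvl i) /\ side_ray r (i + 1) false (lvl i)).
  by move=> [h1 h2]; apply: rs; rewrite -(side_rayI simplex_r neqr h1 h2).
have hitE j c : (forall p, side_ray r j c p -> p 0 i = r 0 i) ->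
    hits_ray j c = `[< side_ray r j c (lvl i) >].
  move=> jc; apply/asboolP/asboolP => [[p [ps jp]]|jl]; last by exists (lvl i).
  by rewrite -(lvlE p)// (jc p).
rewrite !hitE; [|by move=> p /rayF[]|by move=> p /rayT[]].
by case: one => h; [rewrite asboolT// asboolF|rewrite addnC asboolT// asboolF] => // h';
  apply: notboth.
Qed.

Lemma on_segment_separates i : on_segment r -> separates x y i (r 0 i).
Proof. by move=> /asboolP rs; have [/(_ (conj rs erefl))[]] := lvlP i r. Qed.

(* A segment through r is separated by all three lines x_i = r_i, which would
   give 12 crossings for the eight choices of rays, but each choice gives one. *)
Lemma sum_hits_ball :
  (\sum_(c : bool * bool * bool)
     (if on_segment r then 1
      else \sum_j hits_ray j (nth false [:: c.1.1; c.1.2; c.2] j)) + 4 * on_segment r =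
   4 * \sum_i separates x y i (r 0 i)%R)%N.
Proof.
have sum_bool (F : bool -> nat) : (\sum_c F c = F true + F false)%N.
  by rewrite big_bool.
rewrite -(pair_bigA _ (fun c d => if on_segment r then 1%N
      else (\sum_j hits_ray j (nth false [:: c.1; c.2; d] j))%N))/=.
rewrite -(pair_bigA _ (fun c e => \sum_d (if on_segment r then 1%N
      else (\sum_j hits_ray j (nth false [:: c; e; d] j))%N))%N)/=.
rewrite !sum_bool !(@sum_ord3 nat)/=.
have [os|nos] := boolP (on_segment r).
  by rewrite !on_segment_separates.
(* Each of the six rays occurs in four of the eight choices, and the rays pair up into the three
   lines. *)
rewrite -!hits_line// !ord3_add.
move: (hits_ray 0 true) (hits_ray 0 false) (hits_ray 1 true) (hits_ray 1 false)
  (hits_ray 2 true) (hits_ray 2 false).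
by do 6 case.
Qed.

End BallCrossings.

(** * Integration over the sample space *)

(** This disposes of the discrete components of a sample: measurability only has to be checked in
    the real variable. *)
Lemma measurable_fun_fibers d1 d2 (T : measurableType d1) (U : measurableType d2)
    (I : finType) (g : T -> I) (F : I -> T -> U) :
  (forall i, measurable (g @^-1` [set i])) ->
  (forall i, measurable_fun setT (F i)) ->
  measurable_fun setT (fun w => F (g w) w).
Proof.
move=> mg mF _ Y mY; rewrite setTI.
rewrite (_ : _ @^-1` Y = \bigcup_i (g @^-1` [set i] `&` F i @^-1` Y)).
  apply: fin_bigcup_measurable; first exact: finite_finset.
  by move=> i _; apply: measurableI => //; rewrite -[X in measurable X]setTI; exact: mF.
by apply/seteqP; split=> [w Yw|w [i _ [/= <-]]//]; exists (g w).
Qed.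

Lemma measurable_bool_prod d (T : measurableType d) d' (U : measurableType d')
    (F : bool * T -> U) :
  (forall c, measurable_fun setT (fun t => F (c, t))) -> measurable_fun setT F.
Proof.
move=> mF; rewrite (_ : F = fun w => F (w.1, w.2)); last by apply/funext => -[].
apply: (@measurable_fun_fibers _ _ _ _ bool fst (fun c w => F (c, w.2))) => [c|c].
  by rewrite -[X in measurable X]setTI; apply: measurable_fst.
exact: (measurableT_comp (mF c) measurable_snd).
Qed.

Lemma measurable_prod_bool d (T : measurableType d) d' (U : measurableType d')
    (F : T * bool -> U) :
  (forall c, measurable_fun setT (fun t => F (t, c))) -> measurable_fun setT F.
Proof.
move=> mF; rewrite (_ : F = fun w => F (w.1, w.2)); last by apply/funext => -[].
apply: (@measurable_fun_fibers _ _ _ _ bool snd (fun c w => F (w.1, c))) => [c|c].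
  by rewrite -[X in measurable X]setTI; apply: measurable_snd.
exact: (measurableT_comp (mF c) measurable_fst).
Qed.

Lemma measurable_ord_prod n d (T : measurableType d) d' (U : measurableType d')
    (F : 'I_n.+1 * T -> U) :
  (forall s, measurable_fun setT (fun t => F (s, t))) -> measurable_fun setT F.
Proof.
move=> mF; rewrite (_ : F = fun w => F (w.1, w.2)); last by apply/funext => -[].
apply: (@measurable_fun_fibers _ _ _ _ 'I_n.+1 fst (fun c w => F (c, w.2))) => [c|c].
  by rewrite -[X in measurable X]setTI; apply: measurable_fst.
exact: (measurableT_comp (mF c) measurable_snd).
Qed.

Section Integrals.
Local Open Scope ereal_scope.
Variable R : realType.

Lemma integral_prod_coin d (T : measurableType d) (P : probability T R) (p : R)
    (f : T * bool -> \bar R) : (0 <= p <= 1)%R ->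
    (forall w, 0 <= f w) -> (forall c, measurable_fun setT (fun t => f (t, c))) ->
  \int[P \x coin p]_w f w =
    \int[P]_t (p%:E * f (t, true) + (1 - p)%:E * f (t, false)).
Proof.
move=> p01 f0 mf; rewrite fubini_tonelli1//; last exact: measurable_prod_bool.
by apply: eq_integral => t _; rewrite /fubini_F integral_bernoulli_prob.
Qed.

Lemma integral_coin_prod d (T : measurableType d) (P : probability T R) (p : R)
    (f : bool * T -> \bar R) : (0 <= p <= 1)%R ->
    (forall w, 0 <= f w) -> (forall c, measurable_fun setT (fun t => f (c, t))) ->
  \int[coin p \x P]_w f w =
    p%:E * \int[P]_t f (true, t) + (1 - p)%:E * \int[P]_t f (false, t).
Proof.
move=> p01 f0 mf; rewrite fubini_tonelli1//; last exact: measurable_bool_prod.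
rewrite integral_bernoulli_prob// => c; exact: integral_ge0.
Qed.

Lemma integral_uniform_ord n (f : 'I_n.+1 -> \bar R) : (forall s, 0 <= f s) ->
  \int[@uniform_ord R n]_s f s = (n.+1%:R^-1)%:E * \sum_s f s.
Proof.
move=> f0.
have mT (A : set 'I_n.+1) : measurable A by [].
(* On a finite type every function is a combination of indicators of points. *)
rewrite (_ : f = fun s => \sum_i f i * (\1_[set i] s)%:E); last first.
  apply/funext => s; rewrite (bigD1 s)//= big1 ?adde0 => [|i si].
    by rewrite indicE mem_set// mule1.
  by rewrite indicE memNset ?mule0// => si'; move: si; rewrite si' eqxx.
rewrite (ge0_integral_sum _ measurableT); [|by move=> i _ Y mY; exact: mT|
  by move=> i s _; rewrite mule_ge0// lee_fin].
rewrite ge0_sume_distrr//; last first.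
  by move=> i _; apply: sume_ge0 => j _; rewrite mule_ge0// lee_fin.
apply: eq_bigr => i _; rewrite (ge0_integralZl _ measurableT);
  [|by move=> _ Y mY; exact: mT|by move=> s _; rewrite lee_fin|exact: f0].
rewrite integral_indic// setIT muleC; congr (_ * _); last first.
  rewrite (bigD1 i)//= big1 ?adde0 => [|j ji].
    by rewrite indicE mem_set// mule1.
  by rewrite indicE memNset ?mule0// => ij; move: ji; rewrite ij eqxx.
transitivity ((n.+1%:R^-1)%:E * @counting 'I_n.+1 R [set i]) => //.
rewrite (@counting_seq _ _ _ [:: i]) ?mule1//.
by move=> s; rewrite inE; split=> [->|/eqP].
Qed.

Lemma integral_bits (f : bool * bool * bool -> \bar R) : (forall c, 0 <= f c) ->
  \int[bits_law R]_c f c = (8^-1)%:E * \sum_c f c.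
Proof.
move=> f0; have h01 : (0 <= (2^-1 : R) <= 1)%R by lra.
have mB2 (g : bool * bool -> \bar R) : measurable_fun setT g.
  by apply: measurable_bool_prod => c _ Y mY.
have cge0 (a b : \bar R) : 0 <= a -> 0 <= b -> 0 <= (2^-1)%:E * a + (1 - 2^-1)%:E * b.
  by move=> a0 b0; rewrite adde_ge0// mule_ge0// lee_fin; lra.
rewrite (integral_prod_coin _ h01 f0 (fun c => mB2 (fun t => f (t, c)))).
rewrite integral_prod_coin => [|//|w|c _ Y mY //]; last exact: cge0.
rewrite integral_bernoulli_prob => [/=|//|c]; last by rewrite !cge0.
rewrite (eq_bigr (fun c => f (c.1.1, c.1.2, c.2))); last by move=> [[]].
rewrite -(pair_bigA _ (fun c d => f (c.1, c.2, d)))/=.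
rewrite -(pair_bigA _ (fun c e => \sum_d f (c, e, d)))/=.
rewrite !big_bool/=.
have -> : (1 - 2^-1 = 2^-1 :> R)%R by lra.
have -> : (unstable.onem 2^-1 = 2^-1 :> R)%R by rewrite /unstable.onem; lra.
rewrite -!ge0_muleDr;
  try by repeat first [exact: f0|apply: adde_ge0|apply: mule_ge0; first by rewrite lee_fin].
rewrite !muleA -!EFinM.
by have -> : (2^-1 * 2^-1 * 2^-1 = 8^-1 :> R)%R by lra.
Qed.

End Integrals.

(** * Uniform integrals of functions of a clamped variable *)

Section Clamp.
Variables (R : realType) (lo hi : R).
Hypothesis lohi : lo < hi.
Local Notation mu := (@lebesgue_measure R).

Lemma clamp_in t : lo < t < hi -> clamp lo hi t = t.
Proof. by move=> /andP[lt th]; rewrite /clamp max_r ?min_r// ltW. Qed.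

Lemma clamp_itv t : lo <= clamp lo hi t <= hi.
Proof. by rewrite /clamp le_min le_max ge_min !lexx ?orbT (ltW lohi). Qed.

Lemma clamp_lo t : t <= lo -> clamp lo hi t = lo.
Proof. by move=> tl; rewrite /clamp max_l// min_r// ltW. Qed.

Lemma clamp_hi t : hi <= t -> clamp lo hi t = hi.
Proof.
by move=> ht; rewrite /clamp min_l// le_max ht orbT.
Qed.

Lemma clamp_lt t u : lo < t < hi -> (clamp lo hi u < t) = (u < t).
Proof.
by move=> /andP[lt th]; rewrite /clamp gt_min gt_max lt/= [hi < t]ltNge (ltW th).
Qed.

Lemma clamp_gt t u : lo < t < hi -> (t < clamp lo hi u) = (t < u).
Proof.
by move=> /andP[lt th]; rewrite /clamp lt_min lt_max th/= [t < lo]ltNge (ltW lt).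
Qed.

Lemma clamp_le u v : u <= v -> clamp lo hi u <= clamp lo hi v.
Proof.
by move=> uv; rewrite /clamp le_min !ge_min lexx/= ge_max !le_max lexx uv !orbT.
Qed.

(** The number of crossings has an explicit formula [g] only inside the interval and off finitely
    many parameters. Outside the interval clamping makes the function constant, and every subset of
    the finite set [S] is measurable whatever the values there. *)
Lemma measurable_clamp (f g : R -> \bar R) (S : set R) : finite_set S ->
    measurable_fun setT g -> (forall t, lo < t < hi -> ~ S t -> f t = g t) ->
  measurable_fun setT (fun t => f (clamp lo hi t)).
Proof.
move=> finS mg fg.
have mle (c : R) : measurable_fun setT (fun t : R => t <= c).
  by apply: measurable_fun_ler => //; exact: measurable_cst.
have mge (c : R) : measurable_fun setT (fun t : R => c <= t).
  by apply: measurable_fun_ler => //; exact: measurable_cst.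
pose h t := if t <= lo then f lo else if hi <= t then f hi else g t.
have mh : measurable_fun setT h.
  by apply: measurable_fun_ifT => //; apply: measurable_fun_ifT.
have mSub (A : set R) : A `<=` S -> measurable A.
  move=> AS; apply: countable_measurable => //.
  by apply: finite_set_countable; exact: sub_finite_set AS finS.
have fh t : ~ S t -> f (clamp lo hi t) = h t.
  move=> St; rewrite /h; have [tl|lt] := leP t lo; first by rewrite clamp_lo.
  have [ht|th] := leP hi t; first by rewrite clamp_hi.
  by rewrite clamp_in ?lt// fg// lt.
move=> _ Y mY; rewrite setTI.
rewrite (_ : _ @^-1` Y = (S `&` (fun t => f (clamp lo hi t)) @^-1` Y) `|`
    (h @^-1` Y `\` S)).
  apply: measurableU; first by apply: mSub => t [].
  by apply: measurableD; [rewrite -[X in measurable X]setTI; exact: mh|exact: mSub].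
apply/seteqP; split=> [t Yt|t [[]//|[/= Yt St]]]; last by rewrite /= fh.
by have [St|St] := pselect (S t); [left|right; split=> //=; rewrite -fh].
Qed.

Lemma integral_uniform_oo (f : R -> \bar R) :
    measurable_fun setT f -> (forall t, 0 <= f t)%E ->
  (\int[uniform_prob lohi]_t f t = ((hi - lo)^-1)%:E * \int[mu]_(t in `]lo, hi[) f t)%E.
Proof.
move=> mf f0; rewrite integral_uniform//; congr (_ * _)%E.
by apply: integral_itv_bndoo; exact: measurable_funS mf.
Qed.

(** The uniform law charges neither the complement of the open interval nor the finite set [S]. *)
Lemma integral_uniform_clamp (f g : R -> \bar R) (S : set R) : finite_set S ->
    (forall t, 0 <= f t)%E -> (forall t, 0 <= g t)%E -> measurable_fun setT g ->
    (forall t, lo < t < hi -> ~ S t -> f t = g t) ->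
  (\int[uniform_prob lohi]_t f (clamp lo hi t) = \int[uniform_prob lohi]_t g t)%E.
Proof.
move=> finS f0 g0 mg fg.
have mf := measurable_clamp finS mg fg.
rewrite !integral_uniform_oo//; congr (_ * _)%E.
apply: ge0_ae_eq_integral => //.
- exact: measurable_funS mf.
- exact: measurable_funS mg.
exists S; split.
- by apply: countable_measurable => //; exact: finite_set_countable.
- by apply: countable_lebesgue_measure0; exact: finite_set_countable.
move=> t /= /not_implyP[]; rewrite in_itv/= => tI; apply: contra_notP => St.
by rewrite clamp_in// fg.
Qed.

Lemma integral_uniform_between (u v : R) :
  (\int[uniform_prob lohi]_t (((u - (t : R)) * (v - (t : R)) < 0)%R%:R)%:E =
    ((hi - lo)^-1 * `|clamp lo hi u - clamp lo hi v|)%:E)%E.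
Proof.
wlog uv : u v / u <= v => [hw|].
  have [/hw//|/ltW/hw] := leP u v; rewrite distrC => <-.
  by apply: eq_integral => t _; rewrite mulrC.
have E t : (u - t) * (v - t) < 0 = (u < t < v).
  apply/idP/idP => [|/andP[]]; last by nra.
  by move=> H; apply/andP; split; nra.
have mI : measurable `]u, v[ by [].
rewrite (_ : (fun t => _) = fun t => (\1_`]u, v[ t)%:E); last first.
  apply/funext => t; rewrite E indicE; congr ((_ _)%:R%:E).
  by apply/idP/idP => [uvt|/set_mem]; [apply/mem_set; rewrite /= in_itv|rewrite /= in_itv].
rewrite integral_uniform_oo; [|by apply/measurable_EFinP; exact: measurable_indic|
  by move=> t; rewrite lee_fin].
rewrite EFinM; congr (_ * _)%E.
rewrite integral_indic//.
(* Clamping the endpoints of an interval amounts to intersecting it with []lo, hi[]. *)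
transitivity (mu `]clamp lo hi u, clamp lo hi v[%classic); last first.
  rewrite lebesgue_measure_itv/= lte_fin distrC ger0_norm ?subr_ge0 ?clamp_le//.
  case: ltP => [//|/(conj (clamp_le uv))/andP/le_anti ->].
  by rewrite subrr.
congr (lebesgue_measure _).
apply/seteqP; split=> t /=; rewrite !in_itv/=.
  by move=> [/andP[ut tv] tI]; rewrite clamp_lt// clamp_gt// ut.
move=> /andP[ut tv]; have /andP[lu _] := clamp_itv u; have /andP[_ vh] := clamp_itv v.
have tI : lo < t < hi by rewrite (le_lt_trans lu)// (lt_le_trans tv).
by rewrite -(clamp_lt _ tI) -(clamp_gt _ tI) ut.
Qed.

End Clamp.

(** * Expected numbers of crossings *)

Section BallCenter.
Variable R : realType.

(** The coordinates of the centre are affine in [t]. The two segments of centres are exchanged by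
    swapping the last two coordinates, so only the constant term depends on [ac]. *)
Definition center_offset (ac : bool) (i : 'I_3) : R :=
  if i == 0 then 2 / 3 else if (i == 1) == ac then 1 / 3 else 0.

Definition center_slope (i : 'I_3) : R := if i == 0 then - (2 / 3) else 1 / 3.

Lemma center_slope_neq0 i : center_slope i != 0.
Proof.
by rewrite /center_slope; case: ifP => _; [rewrite lt_eqF//; lra|rewrite gt_eqF//; lra].
Qed.

Lemma ball_centerE ac t i :
  ball_center ac t 0 i = center_offset ac i + center_slope i * t.
Proof.
by elim/ord3_ind: i; case: ac; rewrite /center_offset /center_slope !mxE /=; lra.
Qed.

Lemma simplex_ball_center ac (t : R) : 0 <= t <= 1 -> simplex (ball_center ac t).
Proof.
move=> /andP[t0 t1]; apply/simplex3P; rewrite !ball_centerE.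
by case: ac; rewrite /center_offset /center_slope /=; split; lra.
Qed.

Lemma ball_center_gt0 ac (t : R) i : 0 < t < 1 -> 0 < ball_center ac t 0 i.
Proof.
move=> /andP[t0 t1]; rewrite ball_centerE.
by elim/ord3_ind: i; case: ac; rewrite /center_offset /center_slope /=; lra.
Qed.

Lemma ball_center_conv ac (a b l : R) :
  ball_center ac ((1 - l) * a + l * b) =
    (1 - l) *: ball_center ac a + l *: ball_center ac b.
Proof. by apply/rowP => i; rewrite segment_coord !ball_centerE; ring. Qed.

(** No slope vanishes, so each coordinate of the centre takes a given value at most once. *)
Lemma finite_center_level ac (z : 'rV[R]_3) :
  finite_set [set t | exists i, z 0 i = ball_center ac t 0 i].
Proof.
pose f (i : 'I_3) := (z 0 i - center_offset ac i) / center_slope i.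
apply: (@sub_finite_set _ _ (f @` setT)); last exact/finite_image/finite_finset.
move=> t [i zi]; exists i => //; rewrite /f zi ball_centerE.
rewrite [X in X - _]addrC addrK mulrAC divff ?mul1r//.
exact: center_slope_neq0.
Qed.

End BallCenter.

Lemma convex_is_interval (R : realType) (A : set R) :
  (forall a b l, A a -> A b -> 0 <= l <= 1 -> A ((1 - l) * a + l * b)) ->
  is_interval A.
Proof.
move=> cA a b Aa Ab z /andP[az zb].
have [ab|ab] := eqVneq a b; first by rewrite (_ : z = a)//; apply/le_anti; rewrite az ab zb.
have {ab}ab : 0 < b - a by rewrite subr_gt0 lt_neqAle ab (le_trans az zb).
have ba : b - a != 0 :> R by rewrite gt_eqF.
have zE : (1 - (z - a) / (b - a)) * a + (z - a) / (b - a) * b = z :> R by field.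
rewrite -zE; apply: cA => //; apply/andP; split.
  by apply: divr_ge0; lra.
by rewrite ler_pdivrMr//; lra.
Qed.

Lemma segment_conv (R : realType) k (x y p q : 'rV[R]_k) l : 0 <= l <= 1 ->
  segment x y p -> segment x y q -> segment x y ((1 - l) *: p + l *: q).
Proof.
move=> /andP[l0 l1] [s + <-] [t + <-]; rewrite /= !in_itv/= => /andP[s0 s1] /andP[t0 t1].
exists ((1 - l) * s + l * t); first by rewrite /= in_itv/=; apply/andP; split; nra.
by apply/rowP => i; rewrite !mxE; ring.
Qed.

Lemma seglen_gt0 (R : realType) k (x y : 'rV[R]_k) : x != y -> 0 < seglen x y.
Proof.
move=> xy; rewrite /seglen mulr_gt0// lt_neqAle sumr_ge0// andbT eq_sym.
apply: contra xy; rewrite psumr_eq0// => /allP xy; apply/eqP/rowP => i.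
by have := xy i; rewrite mem_index_enum normr_eq0 subr_eq0 => /(_ isT)/eqP.
Qed.

(** * Average over the rays and the position of the centre *)

Section BallCount.
Variables (R : realType) (x y : 'rV[R]_3).
Hypotheses (sx : simplex x) (sy : simplex y) (xy : x != y).
Implicit Types (ac : bool) (c : bool * bool * bool) (t : R).

Definition bits_fun c (j : 'I_3) : bool := nth false [:: c.1.1; c.1.2; c.2] j.

Definition ball_crossings ac c t : \bar R :=
  ncrossings (cut_along (ball_boundary (ball_center ac t) (bits_fun c))) x y.

Definition ball_count ac c t : \bar R :=
  (if on_segment x y (ball_center ac t) then 1
   else \sum_j hits_ray (ball_center ac t) x y j (bits_fun c j))%N%:R%:E.

Definition degenerate ac : set R :=
  [set t | exists i, x 0 i = ball_center ac t 0 i] `|`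
  [set t | exists i, y 0 i = ball_center ac t 0 i].

Lemma finite_degenerate ac : finite_set (degenerate ac).
Proof. by rewrite finite_setU; split; exact: finite_center_level. Qed.

Lemma ball_crossingsE ac c t : 0 < t < 1 -> ~ degenerate ac t ->
  ball_crossings ac c t = ball_count ac c t.
Proof.
move=> t01 dt; rewrite /ball_crossings ncrossings_ball//.
- by move=> i; exact: ball_center_gt0.
- by apply: simplex_ball_center; case/andP: t01 => /ltW -> /ltW ->.
- by move=> i; apply/eqP => xi; apply: dt; left; exists i.
- by move=> i; apply/eqP => xi; apply: dt; right; exists i.
Qed.

(** This is [sum_hits_ball] divided by 8, the number of choices of rays. *)
Lemma ball_crossings_avg ac t : 0 < t < 1 -> ~ degenerate ac t ->
  ((8^-1)%:E * (\sum_c ball_crossings ac c t)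
    + (2^-1 * (on_segment x y (ball_center ac t))%:R)%:E =
   (2^-1 * \sum_i (separates x y i (ball_center ac t 0 i))%:R)%:E)%E.
Proof.
move=> t01 dt; under eq_bigr do rewrite ball_crossingsE//.
rewrite /ball_count sumEFin -natr_sum -[in RHS]natr_sum -EFinM -EFinD; congr _%:E.
have := @sum_hits_ball R (ball_center ac t) x y.
have r0 i : 0 < ball_center ac t 0 i by exact: ball_center_gt0.
have sr : simplex (ball_center ac t).
  by apply: simplex_ball_center; case/andP: t01 => /ltW -> /ltW ->.
have xr i : x 0 i != ball_center ac t 0 i.
  by apply/eqP => xi; apply: dt; left; exists i.
have yr i : y 0 i != ball_center ac t 0 i.
  by apply/eqP => xi; apply: dt; right; exists i.
move=> /(_ sr sx sy xr yr)/(congr1 (fun n => n%:R : R)).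
by rewrite natrD !natrM => H; lra.
Qed.

(** The conditions are linear jointly in the centre and the point hit, and the centre is affine in
    [t]. The parameters with a hit therefore form a convex set of reals, that is, an interval. *)
Lemma measurable_hits_ray ac j b :
  measurable_fun setT (fun t => hits_ray (ball_center ac t) x y j b).
Proof.
apply: (measurable_fun_bool true); rewrite setTI; apply: is_interval_measurable.
apply: convex_is_interval => s t l /asboolP[p [ps pj]] /asboolP[q [qs qj]] l01.
apply/asboolP; exists ((1 - l) *: p + l *: q).
have ms := segment_conv l01 ps qs; split=> //.
have sm := segment_simplex sx sy ms.
have sp := segment_simplex sx sy ps; have sq := segment_simplex sx sy qs.
have /andP[l0 l1] := l01.
have le i : ball_center ac s 0 i <= p 0 i -> ball_center ac t 0 i <= q 0 i ->
    ball_center ac ((1 - l) * s + l * t) 0 i <= ((1 - l) *: p + l *: q) 0 i.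
  by move=> pi qi; rewrite ball_center_conv !segment_coord lerD// ler_wpM2l// subr_ge0.
have eq i : p 0 i = ball_center ac s 0 i -> q 0 i = ball_center ac t 0 i ->
    ((1 - l) *: p + l *: q) 0 i = ball_center ac ((1 - l) * s + l * t) 0 i.
  by move=> pi qi; rewrite ball_center_conv !segment_coord pi qi.
by case: b pj qj => -[_ pe pl] [_ qe ql]; split=> //;
  [exact: eq|exact: le|exact: eq|exact: le].
Qed.

Lemma measurable_on_segment ac :
  measurable_fun setT (fun t => on_segment x y (ball_center ac t)).
Proof.
apply: (measurable_fun_bool true); rewrite setTI; apply: is_interval_measurable.
apply: convex_is_interval => s t l /asboolP ps /asboolP qs l01; apply/asboolP.
by rewrite ball_center_conv; exact: segment_conv.
Qed.

Lemma measurable_natr_bool (h : R -> bool) : measurable_fun setT h ->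
  measurable_fun setT (fun t => (h t)%:R : R).
Proof.
move=> mh; rewrite (_ : (fun t => _) = fun t => if h t then 1 else 0).
  by apply: measurable_fun_ifT => //; exact: measurable_cst.
by apply/funext => t; case: (h t).
Qed.

Lemma measurable_ball_count ac c : measurable_fun setT (ball_count ac c).
Proof.
rewrite (_ : ball_count ac c = EFin \o fun t =>
  if on_segment x y (ball_center ac t) then 1
  else \sum_j (hits_ray (ball_center ac t) x y j (bits_fun c j))%:R).
  apply/measurable_EFinP; apply: measurable_fun_ifT; first exact: measurable_on_segment.
    exact: measurable_cst.
  apply: measurable_sum => j; apply: measurable_natr_bool; exact: measurable_hits_ray.
by apply/funext => t; rewrite /ball_count /=; case: ifP => // _; rewrite natr_sum.
Qed.

Lemma measurable_ball_crossings ac c :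
  measurable_fun setT (fun t => ball_crossings ac c (clamp 0 1 t)).
Proof.
apply: (measurable_clamp ltr01 (finite_degenerate ac) (measurable_ball_count ac c)).
by move=> t t01 dt; exact: ball_crossingsE.
Qed.

(** The length of the set of [t] in [[0, 1]] for which coordinate [i] of the centre lies between
    [x_i] and [y_i]. *)
Definition center_dist ac i : R :=
  `|clamp 0 1 ((x 0 i - center_offset R ac i) / center_slope R i) -
    clamp 0 1 ((y 0 i - center_offset R ac i) / center_slope R i)|.

(** Dividing both factors by the slope divides the product by a positive square, so the sign of the
    slope does not matter. *)
Lemma separates_center ac i t : separates x y i (ball_center ac t 0 i) =
  (((x 0 i - center_offset R ac i) / center_slope R i - t) *
   ((y 0 i - center_offset R ac i) / center_slope R i - t) < 0).
Proof.
rewrite /separates ball_centerE; have k0 := center_slope_neq0 R i.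
set k := center_slope R i in k0 *; set a := center_offset R ac i.
rewrite -[RHS](pmulr_llt0 _ (_ : 0 < k ^+ 2)) ?exprn_even_gt0//.
by congr (_ < 0); field.
Qed.

Local Open Scope ereal_scope.

(** The factor 1/2 is the shortfall of a segment through the centre: one crossing instead of 3/2. *)
Definition segment_mass ac : \bar R :=
  \int[uniform_prob (@ltr01 R)]_t
    ((2^-1 * (on_segment x y (ball_center ac (clamp 0 1 (t : R))))%:R)%R%:E).

Lemma segment_mass_ge0 ac : 0 <= segment_mass ac.
Proof. by apply: integral_ge0 => t _; rewrite lee_fin mulr_ge0. Qed.

Lemma measurable_on_segment_clamp ac : measurable_fun setT (fun t : R =>
  (2^-1 * (on_segment x y (ball_center ac (clamp 0 1 t)))%:R)%R%:E : \bar R).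
Proof.
apply: (measurable_clamp ltr01 (finite_set0 R)
  (f := fun t => (2^-1 * (on_segment x y (ball_center ac t))%:R)%R%:E : \bar R)
  (g := fun t => (2^-1 * (on_segment x y (ball_center ac t))%:R)%R%:E : \bar R)) => //.
apply/measurable_EFinP; apply: measurable_funM; first exact: measurable_cst.
by apply: measurable_natr_bool; exact: measurable_on_segment.
Qed.

Lemma integral_ball_center ac :
  \int[uniform_prob (@ltr01 R)]_t
     ((8^-1)%:E * \sum_c ball_crossings ac c (clamp 0 1 (t : R)))
   + segment_mass ac = (2^-1 * \sum_i center_dist ac i)%:E.
Proof.
have nc0 c t : 0 <= ball_crossings ac c t.
  exact: ncrossings_ge0.
have mN : measurable_fun setT (fun t : R =>
    (8^-1)%:E * \sum_c ball_crossings ac c (clamp 0 1 t)).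
  apply: emeasurable_funM; first exact: measurable_cst.
  by apply: emeasurable_sum => c; exact: measurable_ball_crossings.
have N0 t : 0 <= (8^-1)%:E * \sum_c ball_crossings ac c t.
  by rewrite mule_ge0 ?lee_fin ?sume_ge0.
have O0 t : 0 <= (2^-1 * (on_segment x y (ball_center ac t))%:R)%R%:E :> \bar R.
  by rewrite lee_fin mulr_ge0.
rewrite /segment_mass -ge0_integralD;
  [|exact: measurableT|by move=> t _; exact: N0|exact: mN|by move=> t _; exact: O0|
    exact: measurable_on_segment_clamp].
have msep i : measurable_fun setT (fun t : R => separates x y i (ball_center ac t 0%R i)).
  rewrite /separates; under eq_fun do rewrite ball_centerE.
  apply: measurable_fun_ltr; last exact: measurable_cst.
  by apply: measurable_funM; apply: measurable_funB; rewrite ?measurable_cst//;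
    apply: measurable_funD => //; apply: measurable_funM.
have msepE i : measurable_fun setT (fun t : R =>
    ((separates x y i (ball_center ac t 0%R i))%:R%:E : \bar R)).
  by apply/measurable_EFinP; exact: measurable_natr_bool.
have sep0 i t : 0 <= (separates x y i (ball_center ac t 0%R i))%:R%:E :> \bar R.
  by rewrite lee_fin.
rewrite (integral_uniform_clamp ltr01 (finite_degenerate ac)
  (f := fun t => (8^-1)%:E * (\sum_c ball_crossings ac c t)
    + (2^-1 * (on_segment x y (ball_center ac t))%:R)%:E)
  (g := fun t => (2^-1)%:E * \sum_i (separates x y i (ball_center ac t 0%R i))%:R%:E)).
- rewrite (ge0_integralZl _ measurableT); first last.
  + by rewrite lee_fin.
  + by move=> t _; rewrite sume_ge0.
  + exact: emeasurable_sum.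
  rewrite EFinM (ge0_integral_sum _ measurableT); [|by []|by []].
  rewrite -sumEFin; congr (_ * _); apply: eq_bigr => i _.
  under eq_integral do rewrite separates_center.
  by rewrite integral_uniform_between subr0 invr1 mul1r.
- by move=> t; rewrite adde_ge0.
- by move=> t; rewrite mule_ge0 ?lee_fin ?sume_ge0.
- by apply: emeasurable_funM; [exact: measurable_cst|exact: emeasurable_sum].
- by move=> t t01 dt; rewrite ball_crossings_avg// EFinM -sumEFin.
Qed.

End BallCount.

(** * Average over the corner cuts *)

Section CornerCount.
Variables (R : realType) (x y : 'rV[R]_3).
Hypotheses (sx : simplex x) (sy : simplex y) (xy : x != y).
Implicit Types (s i : 'I_3) (rho : R).

Definition corner_crossings s rho : \bar R :=
  ncrossings (cut_along (corner_boundary s rho)) x y.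

Definition corner_count s rho : \bar R :=
  (\sum_i ((i != s) && separates x y i rho))%:R%:E.

Definition levels : set R :=
  [set x 0 i | i in [set: 'I_3]] `|` [set y 0 i | i in [set: 'I_3]].

Lemma finite_levels : finite_set levels.
Proof. by rewrite finite_setU; split; exact/finite_image/finite_finset. Qed.

Lemma corner_crossingsE s rho : 2 / 3 < rho < 1 -> ~ levels rho ->
  corner_crossings s rho = corner_count s rho.
Proof.
move=> /andP[lo hi] lr; rewrite /corner_crossings ncrossings_corner//.
- by move=> i; apply/eqP => xi; apply: lr; left; exists i.
- by move=> i; apply/eqP => yi; apply: lr; right; exists i.
Qed.

Lemma measurable_separates i : measurable_fun setT (fun rho => separates x y i rho).
Proof.
rewrite /separates; apply: measurable_fun_ltr; last exact: measurable_cst.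
by apply: measurable_funM; apply: measurable_funB => //; exact: measurable_cst.
Qed.

Lemma corner_countE s : corner_count s =
  EFin \o fun rho => \sum_i (if i != s then (separates x y i rho)%:R else 0).
Proof.
apply/funext => rho; rewrite /corner_count /= natr_sum; congr _%:E.
by apply: eq_bigr => i _; case: (i != s).
Qed.

Lemma measurable_corner_count s : measurable_fun setT (corner_count s).
Proof.
rewrite corner_countE; apply/measurable_EFinP; apply: measurable_sum => i.
case: (i != s); last exact: measurable_cst.
by apply: measurable_natr_bool; exact: measurable_separates.
Qed.

Lemma measurable_corner_crossings s :
  measurable_fun setT (fun rho => corner_crossings s (clamp (2 / 3) 1 rho)).
Proof.
apply: (measurable_clamp (corner_range R) finite_levels (measurable_corner_count s)).
by move=> rho rho01 lr; exact: corner_crossingsE.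
Qed.

Lemma measurable_corner_cut :
  measurable_fun setT (fun w : 'I_3 * R => ncrossings (corner_cut w) x y).
Proof.
by apply: measurable_ord_prod => s; exact: measurable_corner_crossings.
Qed.

Definition corner_dist i : R :=
  `|clamp (2 / 3) 1 (x 0 i) - clamp (2 / 3) 1 (y 0 i)|.

(** The density of [rho] is 3, and each coordinate is used for two of the three values of [s],
    whence the factor [3 * (2 / 3) = 2]. *)
Lemma integral_corner_crossings :
  (\int[corner_law R]_w ncrossings (corner_cut w) x y = (2 * \sum_i corner_dist i)%:E)%E.
Proof.
have cc0 s rho : (0 <= corner_crossings s rho)%E.
  exact: ncrossings_ge0.
rewrite /corner_law fubini_tonelli1;
  [|exact: measurable_corner_cut|by move=> w; exact: cc0].
rewrite /fubini_F integral_uniform_ord; last first.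
  by move=> s; apply: integral_ge0 => rho _; exact: cc0.
have E s : (\int[uniform_prob (corner_range R)]_rho
    corner_crossings s (clamp (2 / 3) 1 (rho : R)) =
    (\sum_i (if i != s then 3 * corner_dist i else 0))%:E)%E.
  rewrite (integral_uniform_clamp (corner_range R) finite_levels
    (f := corner_crossings s) (g := corner_count s)).
  - transitivity (\int[uniform_prob (corner_range R)]_rho
      (\sum_i (if i != s then (separates x y i (rho : R))%:R else 0)%R%:E))%E.
      by apply: eq_integral => rho _; rewrite corner_countE /= sumEFin.
    rewrite (ge0_integral_sum _ measurableT); last 2 first.
    + move=> i; apply/measurable_EFinP; case: (i != s); last exact: measurable_cst.
      by apply: measurable_natr_bool; exact: measurable_separates.
    + by move=> i rho _; rewrite lee_fin; case: (i != s).
    rewrite -sumEFin; apply: eq_bigr => i _; case: (i != s); last first.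
      exact: integral0.
    rewrite integral_uniform_between; congr (_ * _)%:E.
    by rewrite (_ : 1 - 2 / 3 = 3^-1) ?invrK//; lra.
  - by [].
  - by move=> rho; rewrite lee_fin.
  - exact: measurable_corner_count.
  - by move=> rho; exact: corner_crossingsE.
under eq_bigr do rewrite E.
rewrite sumEFin -EFinM !(@sum_ord3 R) /=; congr _%:E.
by lra.
Qed.

End CornerCount.

Section BallExpectation.
Variables (R : realType) (x y : 'rV[R]_3).
Hypotheses (sx : simplex x) (sy : simplex y) (xy : x != y).
Local Open Scope ereal_scope.

Lemma ball_cutE w : ncrossings (ball_cut w) x y =
  ball_crossings x y w.1.1 w.2 (clamp 0 1 w.1.2).
Proof. by case: w => [[ac t] [[b0 b1] b2]]. Qed.

Lemma measurable_ball_cut : measurable_fun setT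
  (fun w : bool * R * (bool * bool * bool) => ncrossings (ball_cut w) x y).
Proof.
under eq_fun do rewrite ball_cutE.
apply: (@measurable_fun_fibers _ _ _ _ (bool * bool * bool)%type snd
  (fun c w => ball_crossings x y w.1.1 c (clamp 0 1 w.1.2))) => [[[b0 b1] b2]|c].
  rewrite -[X in measurable X]setTI; apply: measurable_snd => //.
  rewrite (_ : [set _] = ([set b0] `*` [set b1]) `*` [set b2]).
    by apply: measurableX => //; exact: measurableX.
  by apply/seteqP; split=> [_ ->|[[? ?] ?] [[/= -> ->] ->]].
apply: (@measurableT_comp _ _ _ _ _ _
  (fun v : bool * R => ball_crossings x y v.1 c (clamp 0 1 v.2)) _ fst) => //.
by apply: measurable_bool_prod => ac; exact: measurable_ball_crossings.
Qed.

Lemma integral_ball_cut :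
  \int[ball_law R]_w ncrossings (ball_cut w) x y +
    (2^-1)%:E * (segment_mass x y true + segment_mass x y false) =
  (4^-1 * \sum_i (center_dist x y true i + center_dist x y false i))%:E.
Proof.
rewrite /ball_law fubini_tonelli1;
  [|exact: measurable_ball_cut|by move=> w; exact: ncrossings_ge0].
pose F (z : bool * R) := (8^-1)%:E * \sum_c ball_crossings x y z.1 c (clamp 0 1 z.2).
have nc0 ac c t : 0 <= ball_crossings x y ac c t by exact: ncrossings_ge0.
rewrite [X in X + _](_ : _ = \int[coin 2^-1 \x uniform_prob (@ltr01 R)]_z F z); last first.
  apply: eq_integral => z _; rewrite /fubini_F integral_bits; last first.
    by move=> c; exact: ncrossings_ge0.
  by congr (_ * _); apply: eq_bigr => c _; rewrite ball_cutE.
have F0 z : 0 <= F z by rewrite /F mule_ge0 ?lee_fin ?sume_ge0.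
have mF ac : measurable_fun setT (fun t => F (ac, t)).
  apply: emeasurable_funM; first exact: measurable_cst.
  by apply: emeasurable_sum => c; exact: measurable_ball_crossings.
have h01 : (0 <= (2^-1 : R) <= 1)%R by lra.
rewrite (@integral_coin_prod R _ _ (uniform_prob (@ltr01 R)) _ F h01 F0 mF).
have -> : (1 - 2^-1 = 2^-1 :> R)%R by lra.
have I0 ac : 0 <= \int[uniform_prob (@ltr01 R)]_t F (ac, t) by exact: integral_ge0.
(* Nonnegativity justifies distributing the product over sums of extended reals. *)
have factor (h a b c d u v : \bar R) : 0 <= a -> 0 <= b -> 0 <= c -> 0 <= d ->
    a + c = u -> b + d = v -> h * a + h * b + h * (c + d) = h * (u + v).
  move=> a0 b0 c0 d0 <- <-.
  by rewrite addeACA (ge0_muleDr h (adde_ge0 a0 b0) (adde_ge0 c0 d0)) (ge0_muleDr h a0 b0).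
rewrite (factor _ _ _ _ _ _ _ (I0 true) (I0 false) (segment_mass_ge0 x y true)
  (segment_mass_ge0 x y false) (integral_ball_center sx sy xy true)
  (integral_ball_center sx sy xy false)).
rewrite -EFinD -EFinM; congr _%:E.
by rewrite big_split /=; lra.
Qed.

End BallExpectation.

(** * Balance between ball cuts and corner cuts in each coordinate *)

Section Total.
Variables (R : realType) (x y : 'rV[R]_3).
Hypotheses (sx : simplex x) (sy : simplex y) (xy : x != y).

(** For [i = 0] both segments of centres sweep [[0, 2/3]] with density 3/2; for the other
    coordinates they sweep [[0, 1/3]] and [[1/3, 2/3]] with density 3. Either way the two values of
    [center_dist] add up to three times the part of [[x_i, y_i]] in [[0, 2/3]]. *)
Lemma crossing_dist (i : 'I_3) :
  8 / 11 * (4^-1 * (center_dist x y true i + center_dist x y false i))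
    + 3 / 11 * (2 * corner_dist x y i) = 6 / 11 * `|x 0 i - y 0 i|.
Proof.
have x0 : 0 <= x 0 i by case: sx.
have y0 : 0 <= y 0 i by case: sy.
have x1 := simplex_le1 i sx; have y1 := simplex_le1 i sy.
rewrite /center_dist /corner_dist /center_offset /center_slope.
move: (x 0 i) (y 0 i) x0 x1 y0 y1 => a b a0 a1 b0 b1.
have c01 (t : R) : [\/ t <= 0 /\ clamp 0 1 t = 0, 0 <= t <= 1 /\ clamp 0 1 t = t |
    1 <= t /\ clamp 0 1 t = 1].
  have [t0|t0] := leP t 0; first by constructor 1; rewrite clamp_lo.
  have [t1|t1] := leP 1 t; first by constructor 3; rewrite clamp_hi.
  by constructor 2; rewrite clamp_in ?t0// !ltW.
have c23 (t : R) : t <= 1 -> [\/ t <= 2 / 3 /\ clamp (2 / 3) 1 t = 2 / 3 |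
    2 / 3 <= t /\ clamp (2 / 3) 1 t = t].
  move=> t1; have [t0|t0] := leP t (2 / 3).
    by left; rewrite clamp_lo//; exact: corner_range.
  right; split; first exact: ltW.
  have [t1'|t1'] := leP 1 t; last by rewrite clamp_in// t0.
  by rewrite clamp_hi//; lra.
wlog ab : a b a0 a1 b0 b1 / a <= b.
  move=> hw; have [ab|/ltW ba] := leP a b; first exact: hw.
  rewrite (distrC a b) -(hw b a b0 b1 a0 a1 ba).
  by congr (8 / 11 * (4^-1 * (_ + _)) + 3 / 11 * (2 * _)); exact: distrC.
have abs (u v : R) : u <= v -> `|u - v| = v - u.
  by move=> uv; rewrite distrC ger0_norm// subr_ge0.
have k_ab := clamp_le (2 / 3) 1 ab.
rewrite !(abs _ _ ab) (abs _ _ k_ab); have ka := c23 a a1; have kb := c23 b b1.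
have third (u : R) : (u - 0) / (1 / 3) = 3 * u by field.
have third' (u : R) : (u - 1 / 3) / (1 / 3) = 3 * u - 1 by field.
have two_third (u : R) : (u - 2 / 3) / (- (2 / 3)) = 1 - 3 / 2 * u by field.
(* For a single endpoint the clamped terms combine to an affine function; subtracting its values at
   [a] and [b] gives the claim. *)
have sum_clamp (u : R) : 0 <= u -> u <= 1 ->
    clamp 0 1 (3 * u) + clamp 0 1 (3 * u - 1) + 3 * clamp (2 / 3) 1 u = 3 * u + 2.
  move=> u0 u1; case: (c01 (3 * u)) => -[]; case: (c01 (3 * u - 1)) => -[];
    by case: (c23 u u1) => -[]; lra.
have sum_clamp0 (u : R) : 0 <= u -> u <= 1 ->
    3 / 2 * clamp (2 / 3) 1 u - clamp 0 1 (1 - 3 / 2 * u) = 3 / 2 * u.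
  by move=> u0 u1; case: (c01 (1 - 3 / 2 * u)) => -[]; case: (c23 u u1) => -[]; lra.
have c3 : clamp 0 1 (3 * a) <= clamp 0 1 (3 * b) by apply: clamp_le; lra.
have c31 : clamp 0 1 (3 * a - 1) <= clamp 0 1 (3 * b - 1) by apply: clamp_le; lra.
have c2 : clamp 0 1 (1 - 3 / 2 * b) <= clamp 0 1 (1 - 3 / 2 * a) by apply: clamp_le; lra.
have := sum_clamp a a0 a1; have := sum_clamp b b0 b1.
have := sum_clamp0 a a0 a1; have := sum_clamp0 b b0 b1.
elim/ord3_ind: i => /=; rewrite ?third ?third' ?two_third.
(* The slope of coordinate 0 is negative, which reverses the order of the two clamped values. *)
- by rewrite distrC (abs _ _ c2); lra.
- by rewrite (abs _ _ c3) (abs _ _ c31); lra.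
- by rewrite (abs _ _ c3) (abs _ _ c31); lra.
Qed.

End Total.

Section Mixture.
Local Open Scope ereal_scope.
Context d1 d2 (T1 : measurableType d1) (T2 : measurableType d2) (R : realType).
Variables (P : probability T1 R) (Q : probability T2 R) (p : R).
Variables (f : T1 -> \bar R) (g : T2 -> \bar R).
Hypotheses (f0 : forall u, 0 <= f u) (g0 : forall v, 0 <= g v).
Hypotheses (mf : measurable_fun setT f) (mg : measurable_fun setT g).

Lemma measurable_mixture : measurable_fun setT
  (fun w : bool * T1 * T2 => if w.1.1 then f w.1.2 else g w.2).
Proof.
apply: measurable_fun_ifT.
- exact: (@measurableT_comp _ _ _ _ _ _ fst _ fst).
- apply: (@measurableT_comp _ _ _ _ _ _ f _ (snd \o fst)) => //.
  exact: (@measurableT_comp _ _ _ _ _ _ snd _ fst).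
- exact: (@measurableT_comp _ _ _ _ _ _ g _ snd).
Qed.

(* [M] is [coin p \x P], taken as an abstract probability because its
   sigma-finiteness is not inferred inside [_ \x Q]. *)
Lemma integral_mixture (M : probability (bool * T1)%type R) :
    (forall F : bool * T1 -> \bar R, (forall z, 0 <= F z) ->
      (forall c, measurable_fun setT (fun u => F (c, u))) ->
      \int[M]_z F z =
        p%:E * \int[P]_u F (true, u) + (1 - p)%:E * \int[P]_u F (false, u)) ->
  \int[M \x Q]_w (if w.1.1 then f w.1.2 else g w.2) =
  p%:E * \int[P]_u f u + (1 - p)%:E * \int[Q]_v g v.
Proof.
move=> integralM.
have F0 (w : bool * T1 * T2) : 0 <= (if w.1.1 then f w.1.2 else g w.2) by case: w.1.1.
transitivity (\int[M]_z \int[Q]_v (if z.1 then f z.2 else g v)).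
  exact: (@fubini_tonelli1 _ _ _ _ R M Q _ measurable_mixture F0).
have cstE d (T : measurableType d) (S : probability T R) (c : \bar R) :
    \int[S]_t c = c.
  by rewrite integral_cst// [X in _ * X]probability_setT mule1.
have g_ge0 : 0 <= \int[Q]_v g v by exact: integral_ge0.
(* When the first coin selects [f], the inner integrand is constant and [Q] has mass 1. *)
pose F (z : bool * T1) := if z.1 then f z.2 else \int[Q]_v g v.
transitivity (\int[M]_z F z).
  by apply: eq_integral => -[[] u] _; rewrite /F/= ?cstE.
rewrite integralM; first by rewrite /F/= cstE.
- by move=> [[] u]; [exact: f0|exact: g_ge0].
- by case=> //=; exact: measurable_cst.
Qed.

End Mixture.

(** * Expected number of crossings and density of the scheme *)

Section Expectation.
Variables (R : realType) (x y : 'rV[R]_3).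
Hypotheses (sx : simplex x) (sy : simplex y) (xy : x != y).
Local Open Scope ereal_scope.

Lemma ball_cornerE w : ncrossings (outcome (ball_corner R) w) x y =
  if w.1.1 then ncrossings (ball_cut w.1.2) x y else ncrossings (corner_cut w.2) x y.
Proof. by case: w => [[[] u] v]. Qed.

Lemma measurable_ball_corner : measurable_fun setT
  (fun w => ncrossings (outcome (ball_corner R) w) x y).
Proof.
under eq_fun do rewrite ball_cornerE.
exact: measurable_mixture (measurable_ball_cut sx sy xy) (measurable_corner_cut sx sy xy).
Qed.

Lemma total_mass_ge0 :
  0 <= (2^-1)%:E * (segment_mass x y true + segment_mass x y false).
Proof.
apply: mule_ge0; first by rewrite lee_fin.
exact: adde_ge0 (segment_mass_ge0 x y true) (segment_mass_ge0 x y false).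
Qed.

(** The correction for segments through the centre stays on the left as a nonnegative summand, so
    that no extended reals are subtracted. *)
Lemma integral_ball_corner :
  \int[law (ball_corner R)]_w ncrossings (outcome (ball_corner R) w) x y +
    (8 / 11)%:E * ((2^-1)%:E * (segment_mass x y true + segment_mass x y false)) =
  (12 / 11 * seglen x y)%:E.
Proof.
under eq_integral do rewrite ball_cornerE.
have p01 : (0 <= (8 / 11 : R) <= 1)%R by lra.
have mixtureE := @integral_mixture _ _ _ _ R (ball_law R) (corner_law R) (8 / 11)%R
  (fun u => ncrossings (ball_cut u) x y) (fun v => ncrossings (corner_cut v) x y)
  (fun u => ncrossings_ge0 x y (ball_cut u)) (fun v => ncrossings_ge0 x y (corner_cut v))
  (measurable_ball_cut sx sy xy) (measurable_corner_cut sx sy xy)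
  (coin (8 / 11)%R \x ball_law R)
  (fun F F0 mF => @integral_coin_prod R _ _ (ball_law R) (8 / 11)%R F p01 F0 mF).
rewrite [X in X + _]mixtureE {mixtureE}.
rewrite integral_corner_crossings// addeAC.
have combine (h a b u : \bar R) : 0 <= a -> 0 <= b -> a + b = u -> h * a + h * b = h * u.
  by move=> a0 b0 <-; rewrite (ge0_muleDr h a0 b0).
have ball_ge0 : 0 <= \int[ball_law R]_w ncrossings (ball_cut w) x y.
  by apply: integral_ge0 => w _; exact: ncrossings_ge0.
rewrite (combine _ _ _ _ ball_ge0 total_mass_ge0 (integral_ball_cut sx sy xy)).
rewrite -!EFinM -EFinD; congr _%:E.
have -> : (1 - 8 / 11 = 3 / 11 :> R)%R by lra.
have -> : (12 / 11 * seglen x y = \sum_i 6 / 11 * `|x ord0 i - y ord0 i|)%R.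
  by rewrite /seglen -mulr_sumr mulrA; congr (_ * _)%R; lra.
by rewrite !mulr_sumr -big_split; apply: eq_bigr => i _; exact: crossing_dist.
Qed.

Lemma density_le : density (ball_corner R) x y <= (12 / 11)%:E.
Proof.
have l0 := seglen_gt0 xy.
rewrite /density lee_pdivrMr//; rewrite -EFinM -integral_ball_corner leeDl//.
by apply: mule_ge0 total_mass_ge0; rewrite lee_fin; lra.
Qed.

(** The correction then vanishes, since the excluded parameters 0 and 1 have probability zero. *)
Lemma density_eq :
    (forall ac t, (0 < t < 1)%R -> ~~ on_segment x y (ball_center ac t)) ->
  density (ball_corner R) x y = (12 / 11)%:E.
Proof.
move=> off; have l0 := seglen_gt0 xy.
have m0 ac : segment_mass x y ac = 0.
  rewrite /segment_mass (integral_uniform_clamp ltr01 (finite_set0 R)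
    (f := fun t => (2^-1 * (on_segment x y (ball_center ac t))%:R)%R%:E) (g := cst 0)).
  - exact: integral0.
  - by move=> t; rewrite lee_fin mulr_ge0.
  - by [].
  - exact: measurable_cst.
  - by move=> t t01 _; rewrite (negbTE (off ac t t01)) mulr0.
have := integral_ball_corner; rewrite !m0 !adde0 !mule0 adde0 => E.
by rewrite /density E -EFinM mulfK// gt_eqF.
Qed.

End Expectation.

(** * Almost every sample gives a 3-way cut *)

Section AlmostSure.
Variable R : realType.
Local Open Scope ereal_scope.

Lemma uniform_prob_setC_oo (lo hi : R) (lohi : (lo < hi)%R) :
  uniform_prob lohi (~` `]lo, hi[) = 0.
Proof.
have mC : measurable (~` `]lo, hi[ : set R) by exact: measurableC.
transitivity (\int[uniform_prob lohi]_t (\1_(~` `]lo, hi[) (t : R))%:E).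
  by rewrite integral_indic// setIT.
rewrite integral_uniform_oo; [|by apply/measurable_EFinP; exact: measurable_indic|
  by move=> t; rewrite lee_fin].
by rewrite integral_indic// setICl measure0 mule0.
Qed.

(** A cut can only fail if [t] or [rho] lies outside its open interval: clamping then puts the
    centre on a side of the triangle, or [rho] at 2/3 or 1. These samples lie in two boxes, each
    with a factor of measure zero. *)
Lemma ball_corner_kway :
  {ae law (ball_corner R), forall w, kway_cut (outcome (ball_corner R) w)}.
Proof.
pose Z0 : set R := ~` `]0%R, 1%R[; pose Z1 : set R := ~` `](2 / 3)%R, 1%R[.
have mZ0 : measurable Z0 by exact: measurableC.
have mZ1 : measurable Z1 by exact: measurableC.
pose A0 : set (bool * (bool * R * (bool * bool * bool)) * ('I_3 * R)) :=
  ([set: bool] `*` (([set: bool] `*` Z0) `*` [set: bool * bool * bool])) `*` [set: 'I_3 * R].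
pose A1 : set (bool * (bool * R * (bool * bool * bool)) * ('I_3 * R)) :=
  [set: bool * (bool * R * (bool * bool * bool))] `*` ([set: 'I_3] `*` Z1).
have mA0 : measurable A0 by do !apply: measurableX => //.
have mA1 : measurable A1 by do !apply: measurableX => //.
have : (law (ball_corner R)).-negligible (A0 `|` A1).
  apply: negligibleU.
    exists A0; split=> //.
    rewrite [LHS]product_measure1E//; last by do !apply: measurableX => //.
    rewrite [X in X * _]product_measure1E//; last by do !apply: measurableX => //.
    rewrite [X in _ * X * _]product_measure1E//; last by do !apply: measurableX => //.
    rewrite [X in _ * (X * _) * _]product_measure1E//.
    by rewrite [X in _ * (_ * X * _) * _]uniform_prob_setC_oo !(mule0, mul0e).
  exists A1; split=> //.
  rewrite [LHS]product_measure1E//; last by do !apply: measurableX => //.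
  rewrite [X in _ * X]product_measure1E//.
  by rewrite [X in _ * (_ * X)]uniform_prob_setC_oo !(mule0, mul0e).
apply: negligibleS => -[[is_ball [[ac t] [[b0 b1] b2]]] [s rho]] /= nk.
apply: contrapT => /not_orP[nA0 nA1]; apply: nk.
have t01 : (0 < t < 1)%R.
  have [//|/negP nt] := boolP (0 < t < 1)%R; exfalso; apply: nA0.
  by do !split => //; rewrite /Z0 /= in_itv.
have rho01 : (2 / 3 < rho < 1)%R.
  have [//|/negP nr] := boolP (2 / 3 < rho < 1)%R; exfalso; apply: nA1.
  by do !split => //; rewrite /Z1 /= in_itv.
case: is_ball nA0 nA1 => _ _.
  rewrite /ball_cut clamp_in//; apply: ball_kway.
    by move=> i; exact: ball_center_gt0.
  by apply: simplex_ball_center; case/andP: t01 => /ltW -> /ltW ->.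
rewrite /corner_cut/= clamp_in//.
by case/andP: rho01 => lo hi; exact: corner_kway.
Qed.

End AlmostSure.

Theorem theorem4p3 (R : realType) :
  [/\ cutting_scheme (ball_corner R),
      max_density (ball_corner R) = (12 / 11)%:E &
      (opt_density R 3 <= (12 / 11)%:E)%E].
Proof.
have scheme : cutting_scheme (ball_corner R).
  split; first exact: ball_corner_kway.
  by move=> x y sx sy xy; exact: measurable_ball_corner.
have max : max_density (ball_corner R) = (12 / 11)%:E.
  apply/eqP; rewrite eq_le; apply/andP; split.
    by apply: ge_ereal_sup => _ [x [y [sx sy xy ->]]]; exact: density_le.
  have v01 : vertex R 0 != vertex R (1 : 'I_3).
    apply/eqP => /rowP/(_ 0); rewrite !vertexE /= => /eqP.
    by rewrite oner_eq0.
  (* The supremum is attained on the side joining terminals 0 and 1: its points have last coordinate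
     0, while a centre with [0 < t < 1] has positive coordinates. *)
  apply: ereal_sup_ubound; exists (vertex R 0), (vertex R 1).
  split=> //; try exact: simplex_vertex.
  rewrite density_eq//; try exact: simplex_vertex.
  move=> ac t t01; apply/asboolP => -[u _ /rowP/(_ 2)].
  have := ball_center_gt0 ac 2 t01.
  by rewrite segment_coord !vertexE /= !mulr0 addr0 => /[swap] <-; rewrite ltxx.
split=> //.
by rewrite -max; apply: ereal_inf_lbound; exists (ball_corner R).
Qed.
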